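(* There is an absolute constant $k_0$ such that the following holds for all integers $k\ge k_0$, all $\alpha=d/k$ ($d$ an integer) with $(2^{k-1}-2)\ln2\le\alpha\le2^{k-1}\ln2$, and all $\lambda\in[0,1]$. Let $\dot\mu_{\lambda,0}=\frac12\delta_0+\frac12\delta_1$ and recursively $\dot\mu_{\lambda,l+1}=\mathscr R_\lambda\dot\mu_{\lambda,l}$ for $l\ge0$. Let $S_l=\operatorname{supp}\dot\mu_{\lambda,l}\setminus\operatorname{supp}(\dot\mu_{\lambda,0}+\dots+\dot\mu_{\lambda,l-1})$, a finite subset of $[0,1]$ (with $S_0=\{0,1\}$). Regard each $\dot\mu_{\lambda,l}$ as an infinite sequence indexed by the elements of $S_0$ in increasing order, followed by the elements of $S_1$ in increasing order, then those of $S_2$, and so on. Then as $l\to\infty$, $\dot\mu_{\lambda,l}$ converges in the $\ell^1$ sequence space to a limit $\dot\mu_\lambda\in\mathscr P$ which satisfies the fixed point equation $\dot\mu_\lambda=\mathscr R_\lambda\dot\mu_\lambda$, the estimate $\dot\mu_\lambda((0,1))\le 7/2^k$, and the symmetry $\dot\mu_\lambda(dx)=\dot\mu_\lambda(d(1-x))$.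
   Context: $\mathscr P$ is the set of discrete probability measures on $[0,1]$. For $\mu\in\mathscr P$ and measurable $B\subseteq[0,1]$, $$\hat{\mathscr R}_\lambda\mu(B)=\frac1{\hat{\mathscr Z}(\mu)}\int\Big(2-\prod_{i=1}^{k-1}x_i-\prod_{i=1}^{k-1}(1-x_i)\Big)^\lambda \mathbf 1\Big\{\tfrac{1-\prod_{i=1}^{k-1} x_i}{2-\prod_{i=1}^{k-1} x_i-\prod_{i=1}^{k-1}(1-x_i)}\in B\Big\}\prod_{i=1}^{k-1}\mu(dx_i),$$ $$\dot{\mathscr R}_\lambda\mu(B)=\frac1{\dot{\mathscr Z}(\mu)}\int\Big(\prod_{i=1}^{d-1}y_i+\prod_{i=1}^{d-1}(1-y_i)\Big)^\lambda \mathbf 1\Big\{\tfrac{\prod_{i=1}^{d-1} y_i}{\prod_{i=1}^{d-1} y_i+\prod_{i=1}^{d-1}(1-y_i)}\in B\Big\}\prod_{i=1}^{d-1}\mu(dy_i),$$ where $\hat{\mathscr Z}(\mu),\dot{\mathscr Z}(\mu)$ are the normalizing constants making these probability measures; for $\lambda=0$ the convention $0^0=0$ is used. $\mathscr R_\lambda=\dot{\mathscr R}_\lambda\circ\hat{\mathscr R}_\lambda$. *)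

(* Defs.v *)
From HB Require Import structures.
From mathcomp Require Import all_boot all_order all_algebra finmap.
From mathcomp Require Import all_classical all_reals all_analysis.
From mathcomp Require Import measurable_realfun.

Set Implicit Arguments.
Unset Strict Implicit.
Unset Printing Implicit Defensive.

Import Order.TTheory GRing.Theory Num.Theory.
Import numFieldNormedType.Exports.

Local Open Scope classical_set_scope.
Local Open Scope ring_scope.

Section product_power.
Context d (T : measurableType d) (R : realType).

Definition cons_pair n (p : T * n.-tuple T) : n.+1.-tuple T :=
  [the n.+1.-tuple T of p.1 :: p.2].

Lemma measurable_cons_pair n :
  measurable_fun [set: T * n.-tuple T] (@cons_pair n).
Proof. by apply: measurable_cons. Qed.

HB.instance Definition _ n :=
  isMeasurableFun.Build _ _ _ _ (@cons_pair n) (@measurable_cons_pair n).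

(* The n-fold product of [mu] with itself, on T^n. *)
Fixpoint mpow (mu : probability T R) n : probability (n.-tuple T) R :=
  if n is m.+1 then distribution (mu \x mpow mu m)%E (@cons_pair m)
  else \d_([tuple] : 0.-tuple T).

End product_power.

(* The library has [0 `^ 0 = 1]; here [0 ^ 0 = 0]. *)
Definition powR00 (R : realType) (x lambda : R) : R :=
  if x == 0 then 0 else x `^ lambda.

Lemma powR00_ge0 (R : realType) (x l : R) : 0 <= powR00 x l.
Proof. by rewrite /powR00; case: ifP => // _; exact: powR_ge0. Qed.

Lemma measurable_powR00 (R : realType) (l : R) :
  measurable_fun [set: R] ((@powR00 R)^~ l).
Proof.
rewrite /powR00; apply: measurable_fun_ifT => //.
exact: measurable_fun_eqr.
Qed.

Section tilted.
Context d (T : measurableType d) (R : realType) (P : probability T R).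
Variables (w r : {mfun T >-> R}) (lambda : R).
Local Open Scope ereal_scope.

(* The image under [r] of the measure with density [w ^ lambda]
   with respect to [P]. *)
Definition tilted (B : set R) : \bar R :=
  \int[P]_x (powR00 (w x) lambda * \1_B (r x))%:E.

Let tiltedE B : tilted B =
  \int[P]_(x in r @^-1` B) (powR00 (w x) lambda)%:E.
Proof.
rewrite [RHS]integral_mkcond; apply: eq_integral => x _.
rewrite patchE indicE -[x \in _]/(r x \in B).
by case: ifPn => xB; rewrite ?(negbTE xB) ?xB ?mulr1 ?mulr0.
Qed.

Let tilted0 : tilted set0 = 0.
Proof. by rewrite tiltedE preimage_set0 integral_set0. Qed.

Let tilted_ge0 B : 0 <= tilted B.
Proof.
by apply: integral_ge0 => x _; rewrite lee_fin mulr_ge0 ?powR00_ge0.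
Qed.

Let tilted_sigma_additive : semi_sigma_additive tilted.
Proof.
move=> F mF tF mUF; rewrite tiltedE preimage_bigcup.
under eq_fun do under eq_bigr do rewrite tiltedE.
apply: (@semi_sigma_additive_nng_induced _ _ _ P
    (fun x => (powR00 (w x) lambda)%:E)) => //.
- apply/measurable_EFinP.
  exact: (measurableT_comp (measurable_powR00 lambda)).
- by move=> x; rewrite lee_fin powR00_ge0.
- by move=> n; rewrite -[X in measurable X]setTI; exact: measurable_funPT.
- apply/trivIsetP => /= i j _ _ ij; rewrite -preimage_setI.
  by move/trivIsetP : tF => /(_ _ _ _ _ ij) ->//; rewrite preimage_set0.
- by rewrite -preimage_bigcup -[X in measurable X]setTI; exact: measurable_funPT.
Qed.

HB.instance Definition _ := isMeasure.Build _ _ _ tilted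
  tilted0 tilted_ge0 tilted_sigma_additive.

End tilted.

Section recursion_maps.
Context (R : realType) (n : nat).
Implicit Type x : n.-tuple R.

Definition prodt x : R := \prod_(i < n) tnth x i.
Definition prodtC x : R := \prod_(i < n) (1 - tnth x i).

Definition hat_weight x : R := 2 - prodt x - prodtC x.
Definition hat_ratio x : R := (1 - prodt x) / hat_weight x.
Definition dot_weight x : R := prodt x + prodtC x.
Definition dot_ratio x : R := prodt x / dot_weight x.

Lemma measurable_prodt : measurable_fun setT prodt.
Proof. by apply: measurable_prod => i _; exact: measurable_tnth. Qed.

Lemma measurable_prodtC : measurable_fun setT prodtC.
Proof.
apply: measurable_prod => i _; apply: measurable_funB => //.
exact: measurable_tnth.
Qed.

Lemma measurable_hat_weight : measurable_fun setT hat_weight.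
Proof.
apply: measurable_funB; last exact: measurable_prodtC.
by apply: measurable_funB => //; exact: measurable_prodt.
Qed.

Lemma measurable_dot_weight : measurable_fun setT dot_weight.
Proof. exact: measurable_funD measurable_prodt measurable_prodtC. Qed.

Lemma measurable_invr : measurable_fun [set: R] (@GRing.inv R).
Proof.
have o0 : open [set x : R | x != 0] by exact: open_neq.
have -> : [set: R] = [set 0] `|` [set x | x != 0].
  by apply/seteqP; split=> // x _; case: (eqVneq x 0); [left|right].
apply/measurable_funU => //; first exact: open_measurable.
split; first exact: measurable_fun_set1.
apply: open_continuous_measurable_fun => //; apply/in_setP => x /= x0.
exact: inv_continuous.
Qed.

Lemma measurable_hat_ratio : measurable_fun setT hat_ratio.
Proof.
apply: measurable_funM; first by apply: measurable_funB => //; exact: measurable_prodt.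
exact: (measurableT_comp measurable_invr measurable_hat_weight).
Qed.

Lemma measurable_dot_ratio : measurable_fun setT dot_ratio.
Proof.
apply: measurable_funM; first exact: measurable_prodt.
exact: (measurableT_comp measurable_invr measurable_dot_weight).
Qed.

HB.instance Definition _ :=
  isMeasurableFun.Build _ _ _ _ hat_weight measurable_hat_weight.
HB.instance Definition _ :=
  isMeasurableFun.Build _ _ _ _ hat_ratio measurable_hat_ratio.
HB.instance Definition _ :=
  isMeasurableFun.Build _ _ _ _ dot_weight measurable_dot_weight.
HB.instance Definition _ :=
  isMeasurableFun.Build _ _ _ _ dot_ratio measurable_dot_ratio.

End recursion_maps.

Section recursion.
Context (R : realType).
Implicit Type mu : probability R R.

Definition discrete01 mu :=
  exists A : set R, [/\ countable A, A `<=` `[0, 1] & mu A = 1%E].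

(* [mnormalize] divides by the total mass; its last argument is only used when
   that mass is zero or infinite. For [discrete01 mu], 2 <= k and 1 <= d this
   does not occur below: the hat weight is in [1, 2] on [0,1]^(k-1), and the dot
   weight is bounded by 2 and is positive at (y, ..., y) for any atom y of mu. *)
Definition hatR (k : nat) (lambda : R) mu : probability R R :=
  mnormalize (tilted (mpow mu k.-1) (@hat_weight R k.-1) (@hat_ratio R k.-1)
    lambda) \d_(0%R : R).

Definition dotR (d : nat) (lambda : R) mu : probability R R :=
  mnormalize (tilted (mpow mu d.-1) (@dot_weight R d.-1) (@dot_ratio R d.-1)
    lambda) \d_(0%R : R).

Definition RR (k d : nat) (lambda : R) mu : probability R R :=
  dotR d lambda (hatR k lambda mu).

Definition mu_init : set R -> \bar R :=
  measure_add (mscale (2^-1)%:nng \d_(0%R : R)) (mscale (2^-1)%:nng \d_(1%R : R)).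

HB.instance Definition _ := Measure.on mu_init.

Lemma mu_initE A :
  mu_init A = ((2^-1)%:E * \d_(0%R : R) A + (2^-1)%:E * \d_(1%R : R) A)%E.
Proof. exact: measure_addE. Qed.

Let mu_init_setT : mu_init setT = 1%E.
Proof.
rewrite mu_initE !diracT !mule1 -EFinD; congr EFin.
by rewrite [RHS]splitr !mul1r.
Qed.

HB.instance Definition _ :=
  Measure_isProbability.Build _ _ _ mu_init mu_init_setT.

Definition mu_iter (k d : nat) (lambda : R) (l : nat) : probability R R :=
  iter l (RR k d lambda) mu_init.

Definition supp (m : set R -> \bar R) : set R :=
  [set x | forall U, open U -> U x -> (0 < m U)%E].

(* The sets S_l: new support points of the l-th measure. *)
Definition new_supp (mu : nat -> probability R R) (l : nat) : set R :=
  supp (mu l) `\` supp (msum mu l).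

(* The elements of S 0, ..., S n.-1, each in increasing order. *)
Definition enum_prefix (S : nat -> set R) (n : nat) : seq R :=
  flatten [seq sort <=%R (fset_set (S j)) | j <- iota 0 n].

(* The element of index [i] in the concatenation of all the S l, if any. *)
Definition enum_all (S : nat -> set R) (i : nat) : option R :=
  if pselect (exists n, i < size (enum_prefix S n))%N is left ex
  then Some (nth 0 (enum_prefix S (ex_minn ex)) i) else None.

(* The masses of [m] along that enumeration, padded with zeros should the
   enumeration be finite. *)
Definition mass_seq (S : nat -> set R) (m : set R -> \bar R) (i : nat) : R :=
  if enum_all S i is Some x then fine (m [set x]) else 0.

End recursion.

(* Main.v *)
Require Import Defs.
From HB Require Import structures.
From mathcomp Require Import all_boot all_order all_algebra finmap.
From mathcomp Require Import all_classical all_reals all_analysis.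
From mathcomp Require Import measurable_realfun.
From mathcomp Require Import ring lra.

(* Write [eps] for the mass [mu] gives to (0,1). If [mu] is symmetric under
   x -> 1 - x with [eps] at most 7/2^k, its image under the first map is
   concentrated at 1/2 up to mass O(2^-k), since the ratio differs from 1/2 only
   when all k-1 inputs are nonzero or all differ from 1. For the second map the
   output is 0 or 1 unless all d-1 inputs lie in (0,1), an event of relative
   weight [(a / s) ^ (d-1)], with [a] and [s] the integrals of y^lambda over (0,1)
   and (0,1]; as s >= (1 + ((1-eps)/2)^(k-1)) a and d is about k 2^(k-1) ln 2, this
   is at most 2/2^k. By symmetry the mass outside (0,1) is equally split, so two
   outputs differ only through these exceptional parts. Exchanging the inputs
   one at a time costs O(k 2^-k) in the first map and O(d) in the second, so that
   the composition contracts the total variation distance by the factor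
   O(d * k 2^-k * 2^-k) = O(k^2 2^-k). Total variation bounds the l^1 distance of
   the mass sequences because the enumeration of the support is injective. *)

Import Order.TTheory GRing.Theory Num.Theory.
Import numFieldNormedType.Exports.

Local Open Scope classical_set_scope.
Local Open Scope ring_scope.

Set Implicit Arguments.
Unset Strict Implicit.
Unset Printing Implicit Defensive.

(** * Means of bounded measurable functions and total variation *)

(** The main obstacle is the size of the second normaliser. It is of order s^(d-1), which can be
    exponentially small in d, so every error has to be measured relative to s^(d-1). This is why the
    exchange of coordinates keeps a factor c^(n-1); the bound a >= 1/4 turns it back into an n-th
    power at bounded cost. The other obstacle is uniformity in lambda. If all inputs of the first
    map are 0, its output is 1 with weight 1, against a normaliser of at most 2^lambda; hence s - a
    >= b 2^-lambda with b = ((1-eps)/2)^(k-1). Symmetry and concavity of y^lambda give a <=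
    2^-lambda. The powers of 2 cancel, and s >= (1 + b) a holds with a factor free of lambda. The
    constant 7 leaves slack: one application of the composed map already brings the mass of (0,1)
    down to 4/2^k. *)

Definition bounded_measurable d (T : measurableType d) (R : realType)
    (f : T -> R) : Prop :=
  measurable_fun [set: T] f /\ exists M : R, forall x, `|f x| <= M.

(** Means are real numbers. Since the bound on a test function holds everywhere, the rules below ask
    only for [bounded_measurable]; a function bounded almost surely is first cut off by an
    indicator. *)
Definition mean d (T : measurableType d) (R : realType) (P : probability T R)
    (f : T -> R) : R := \int[P]_x f x.

Section bounded_measurable.
Context d (T : measurableType d) (R : realType).
Implicit Types (f g : T -> R) (A : set T).
Local Notation bm := (@bounded_measurable d T R).

Lemma bm_cst c : bm (fun=> c).
Proof. by split=> //; exists `|c|. Qed.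

Lemma bm_add f g : bm f -> bm g -> bm (fun x => f x + g x).
Proof.
move=> [mf [M fM]] [mg [N gN]]; split; first exact: measurable_funD.
by exists (M + N) => x; rewrite (le_trans (ler_normD _ _)) ?lerD.
Qed.

Lemma bm_mul f g : bm f -> bm g -> bm (fun x => f x * g x).
Proof.
move=> [mf [M fM]] [mg [N gN]]; split; first exact: measurable_funM.
by exists (M * N) => x; rewrite normrM ler_pM.
Qed.

Lemma bm_scale c f : bm f -> bm (fun x => c * f x).
Proof. exact/bm_mul/bm_cst. Qed.

Lemma bm_opp f : bm f -> bm (fun x => - f x).
Proof.
move=> [mf [M fM]]; split; first exact: measurableT_comp.
by exists M => x; rewrite normrN.
Qed.

Lemma bm_sub f g : bm f -> bm g -> bm (fun x => f x - g x).
Proof. by move=> bf bg; exact/bm_add/bm_opp. Qed.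

Lemma bm_indic A : measurable A -> bm (\1_A : T -> R).
Proof.
move=> mA; split; first exact: measurable_indic.
by exists 1 => x; rewrite indicE; case: (_ \in _); rewrite ?normr1 ?normr0.
Qed.

Lemma bm_sum (I : Type) (s : seq I) (F : I -> T -> R) :
  (forall i, bm (F i)) -> bm (fun x => \sum_(i <- s) F i x).
Proof.
move=> bF; elim: s => [|i s IH].
  by under eq_fun do rewrite big_nil; exact: bm_cst.
by under eq_fun do rewrite big_cons; exact: bm_add.
Qed.

Lemma bm_prod (I : Type) (s : seq I) (F : I -> T -> R) :
  (forall i, bm (F i)) -> bm (fun x => \prod_(i <- s) F i x).
Proof.
move=> bF; elim: s => [|i s IH].
  by under eq_fun do rewrite big_nil; exact: bm_cst.
by under eq_fun do rewrite big_cons; exact: bm_mul.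
Qed.

Lemma bm_comp d' (T' : measurableType d') (g : T' -> R) (h : T -> T') :
  measurable_fun setT h -> bounded_measurable g -> bm (g \o h).
Proof.
move=> mh [mg [M gM]]; split; first exact: measurableT_comp.
by exists M => x; exact: gM.
Qed.

End bounded_measurable.

#[local] Hint Extern 0 (bounded_measurable (fun=> _)) =>
  exact: bm_cst : core.

Section mean.
Context d (T : measurableType d) (R : realType) (P : probability T R).
Implicit Types (f g : T -> R) (A : set T).
Local Notation bm := (@bounded_measurable d T R).

Lemma bm_integrable f : bm f -> P.-integrable setT (EFin \o f).
Proof.
move=> [mf [M fM]]; apply: measurable_bounded_integrable => //.
  by rewrite [X in (X < _)%E](probability_setT P) ltry.
exists M; split; first exact: num_real.
by move=> N MN x _ /=; exact: le_trans (fM x) (ltW MN).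
Qed.

Lemma EFin_mean f : bm f -> (mean P f)%:E = (\int[P]_x (f x)%:E)%E.
Proof.
move=> bf; rewrite /mean /Rintegral fineK//.
exact/integrable_fin_num/bm_integrable.
Qed.

Lemma mean_cst c : mean P (fun=> c) = c.
Proof.
rewrite /mean Rintegral_cst//.
by rewrite [X in fine X](probability_setT P) /= mulr1.
Qed.

Lemma mean_add f g : bm f -> bm g ->
  mean P (fun x => f x + g x) = mean P f + mean P g.
Proof. by move=> bf bg; apply: RintegralD => //; exact: bm_integrable. Qed.

Lemma mean_sub f g : bm f -> bm g ->
  mean P (fun x => f x - g x) = mean P f - mean P g.
Proof. by move=> bf bg; apply: RintegralB => //; exact: bm_integrable. Qed.

Lemma mean_scale c f : bm f -> mean P (fun x => c * f x) = c * mean P f.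
Proof. by move=> bf; apply: RintegralZl => //; exact: bm_integrable. Qed.

Lemma mean_sum (I : Type) (s : seq I) (F : I -> T -> R) :
  (forall i, bm (F i)) ->
  mean P (fun x => \sum_(i <- s) F i x) = \sum_(i <- s) mean P (F i).
Proof.
move=> bF; elim: s => [|i s IH].
  by rewrite big_nil; under eq_fun do rewrite big_nil; rewrite mean_cst.
rewrite big_cons -IH -mean_add//; last exact: bm_sum.
by congr mean; apply/funext => x; rewrite big_cons.
Qed.

Lemma mean_indic A : measurable A -> mean P (\1_A) = fine (P A).
Proof. by move=> mA; rewrite /mean /Rintegral integral_indic ?setIT. Qed.

Lemma le_mean f g : bm f -> bm g -> (forall x, f x <= g x) ->
  mean P f <= mean P g.
Proof. by move=> bf bg fg; apply: le_Rintegral => //; exact: bm_integrable. Qed.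

Lemma mean_ge0 f : (forall x, 0 <= f x) -> 0 <= mean P f.
Proof. by move=> f0; apply: Rintegral_ge0. Qed.

Lemma norm_mean f g : bm f -> bm g -> (forall x, `|f x| <= g x) ->
  `|mean P f| <= mean P g.
Proof.
move=> bf bg fg; rewrite ler_norml; apply/andP; split.
  rewrite lerNl -mulN1r -mean_scale//; apply: le_mean => //.
    exact: bm_scale.
  by move=> x; rewrite mulN1r (le_trans _ (fg x))// -normrN ler_norm.
by apply: le_mean => // x; rewrite (le_trans _ (fg x))// ler_norm.
Qed.

Lemma norm_mean_le f M : bm f -> (forall x, `|f x| <= M) -> `|mean P f| <= M.
Proof.
by move=> bf fM; rewrite -[leRHS]mean_cst; apply: norm_mean.
Qed.

Lemma mean_indicM A f : measurable A -> P A = 1%E -> bm f ->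
  mean P (fun x => \1_A x * f x) = mean P f.
Proof.
move=> mA PA bf; have [mf [M fM]] := bf.
apply/eqP; rewrite -subr_eq0 -normr_le0 -mean_sub//; last first.
  by apply: bm_mul => //; exact: bm_indic.
have bA : bm (fun x => M * (1 - \1_A x)).
  by apply: bm_scale; apply: bm_sub => //; exact: bm_indic.
apply: le_trans (norm_mean (g := fun x => M * (1 - \1_A x)) _ _ _) _ => //.
- by apply: bm_sub => //; apply: bm_mul => //; exact: bm_indic.
- move=> x; rewrite indicE; case: (_ \in _); rewrite /=.
    by rewrite mul1r !subrr normr0 mulr0.
  by rewrite mul0r subr0 mulr1 sub0r normrN.
rewrite mean_scale; last by apply: bm_sub => //; exact: bm_indic.
rewrite mean_sub//; last exact: bm_indic.
by rewrite mean_cst mean_indic// PA subrr mulr0.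
Qed.

End mean.

Lemma eq_mean d (T : measurableType d) (R : realType) (P : probability T R)
  (f g : T -> R) : f =1 g -> mean P f = mean P g.
Proof. by move=> fg; congr mean; apply/funext. Qed.

Section layer_cake.
Context (R : realType).

(** The sum counts the integers among 1, ..., N that are at most [y], so it is the floor of [y]. *)
Lemma count_levels (N : nat) (y : R) : 0 <= y <= N%:R ->
  y - 1 <= \sum_(j < N) ((j.+1%:R <= y)%R%:R : R) <= y.
Proof.
elim: N y => [|N IH] y /andP[y0 yN].
  by rewrite big_ord0; move: yN; rewrite mulr0n; lra.
rewrite big_ord_recr /=; have [yN'|yN'] := leP y N%:R.
  have /IH /andP[h1 h2] : 0 <= y <= N%:R by rewrite y0.
  have -> : (N.+1%:R <= y) = false.
    by apply/negbTE; rewrite -ltNge (le_lt_trans yN')// ltr_nat.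
  by rewrite addr0 h1.
have -> : \sum_(i < N) ((i.+1%:R <= y)%R%:R : R) = N%:R.
  rewrite -[RHS]mulr1 mulr_natl -[in RHS](card_ord N) -sumr_const.
  apply: eq_bigr => i _; rewrite (le_trans _ (ltW yN'))// ler_nat.
  exact: ltn_ord.
move: yN; rewrite -natr1 => yN.
case: (leP (N%:R + 1) y) => h; rewrite ?addr0 /=; lra.
Qed.

Context d (T : measurableType d).
Local Notation bm := (@bounded_measurable d T R).

(* Discretised layer cake: [f] is within [1/N] of the average of the indicators
   of its superlevel sets at heights [1/N, ..., N/N]. *)
Lemma layer_cake (L L' : (T -> R) -> R) (a dl : R) :
  0 <= a ->
  (forall (J : seq nat) (F : nat -> T -> R), (forall j, bm (F j)) ->
     L (fun x => \sum_(j <- J) F j x) = \sum_(j <- J) L (F j)) ->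
  (forall (J : seq nat) (F : nat -> T -> R), (forall j, bm (F j)) ->
     L' (fun x => \sum_(j <- J) F j x) = \sum_(j <- J) L' (F j)) ->
  (forall c (f : T -> R), bm f -> L (fun x => c * f x) = c * L f) ->
  (forall c (f : T -> R), bm f -> L' (fun x => c * f x) = c * L' f) ->
  (forall (f g : T -> R) (e : R), bm f -> bm g -> (forall x, `|f x - g x| <= e) ->
     `|L f - L g| <= a * e) ->
  (forall (f g : T -> R) (e : R), bm f -> bm g -> (forall x, `|f x - g x| <= e) ->
     `|L' f - L' g| <= a * e) ->
  (forall A, measurable A -> `|L \1_A - L' \1_A| <= dl) ->
  forall f : T -> R, measurable_fun setT f -> (forall x, 0 <= f x <= 1) ->
  `|L f - L' f| <= dl.
Proof.
move=> a0 Ls Ls' Lc Lc' Lb Lb' LL f mf f01.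
have bf : bm f.
  split=> //; exists 1 => x; have /andP[? ?] := f01 x.
  by rewrite ger0_norm.
have key (N : nat) : (0 < N)%N -> `|L f - L' f| <= dl + 2 * a / N%:R.
  move=> N0; have N0' : 0 < N%:R :> R by rewrite ltr0n.
  pose A j := [set x | j.+1%:R <= N%:R * f x].
  have mA j : measurable (A j).
    rewrite -[A j]setTI; apply: measurable_fun_le => //.
    exact: measurable_funM.
  pose s (x : T) : R := N%:R^-1 * \sum_(j <- index_iota 0 N) \1_(A j) x.
  have bS : bm (fun x => \sum_(j <- index_iota 0 N) (\1_(A j) x : R)).
    by apply: bm_sum => j; exact: bm_indic.
  have bs : bm s by exact: bm_scale.
  have fs x : `|f x - s x| <= N%:R^-1.
    have /andP[f0 f1] := f01 x.
    have /count_levels : 0 <= N%:R * f x <= N%:R.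
      by rewrite mulr_ge0//= ler_piMr.
    have -> : \sum_(j < N) ((j.+1%:R <= N%:R * f x)%R%:R : R) =
              \sum_(j <- index_iota 0 N) \1_(A j) x.
      rewrite big_mkord.
      apply: eq_bigr => j _; rewrite indicE; congr (nat_of_bool _)%:R.
      by apply/idP/idP; rewrite inE.
    rewrite /s; set S := \sum_(j <- _) _ => /andP[h1 h2].
    have -> : f x - N%:R^-1 * S = N%:R^-1 * (N%:R * f x - S).
      by rewrite mulrBr mulKf// gt_eqF.
    rewrite normrM gtr0_norm ?invr_gt0// ler_piMr ?invr_ge0// ?ler0n//.
    by rewrite ler_norml; apply/andP; split; lra.
  have h1 := Lb _ _ _ bf bs fs.
  have h2 := Lb' _ _ _ bf bs fs.
  have h3 : `|L s - L' s| <= dl.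
    rewrite /s Lc// Lc'// Ls ?Ls'; try by move=> j; exact: bm_indic.
    rewrite -mulrBr -sumrB normrM gtr0_norm ?invr_gt0//.
    rewrite mulrC ler_pdivrMr//.
    apply: le_trans (ler_norm_sum _ _ _) _.
    apply: (@le_trans _ _ (\sum_(i <- index_iota 0 N) dl)).
      by apply: ler_sum => i _; exact: LL.
    by rewrite big_const_seq count_predT size_iota subn0 iter_addr_0 mulr_natr.
  have -> : L f - L' f = (L f - L s) + (L s - L' s) - (L' f - L' s) by ring.
  apply: le_trans (ler_normB _ _) _.
  apply: le_trans (lerD (ler_normD _ _) (lexx _)) _.
  by lra.
apply/ler_addgt0Pr => e e0.
have [N Ne] : exists N : nat, 2 * a / e < N.+1%:R.
  exists (Num.trunc (2 * a / e)); apply: truncnS_gt.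
apply: le_trans (key N.+1 _) _ => //.
move: Ne; rewrite ltr_pdivrMr// => Ne.
by rewrite lerD2l ler_pdivrMr ?ltr0Sn; lra.
Qed.

End layer_cake.

(** * Total variation distance *)

Section total_variation.
Context d (T : measurableType d) (R : realType).
Implicit Types P Q : probability T R.
Local Notation bm := (@bounded_measurable d T R).

(** With tests valued in [-1, 1] this bounds the total mass of the signed measure [P - Q], twice the
    supremum over events. That normalisation is the one comparable with an l^1 norm, through tests
    built from signs. *)
Definition tv_le P Q (dl : R) : Prop :=
  forall f : T -> R, measurable_fun setT f -> (forall x, `|f x| <= 1) ->
  `|mean P f - mean Q f| <= dl.

Lemma tv_le_sym P Q dl : tv_le P Q dl -> tv_le Q P dl.
Proof. by move=> h f mf f1; rewrite distrC; exact: h. Qed.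

Lemma tv_le_trans P Q S dl dl' : tv_le P Q dl -> tv_le Q S dl' ->
  tv_le P S (dl + dl').
Proof.
move=> h h' f mf f1; rewrite -(subrKA (mean Q f)).
by rewrite (le_trans (ler_normD _ _))// lerD ?h ?h'.
Qed.

Lemma tv_leW P Q dl dl' : tv_le P Q dl -> dl <= dl' -> tv_le P Q dl'.
Proof. by move=> h hd f mf f1; rewrite (le_trans (h _ mf f1)). Qed.

Lemma tv_le_ge0 P Q dl : tv_le P Q dl -> 0 <= dl.
Proof.
by move=> /(_ (fun=> 0)); rewrite !mean_cst subrr normr0; apply.
Qed.

Lemma tv_le_scale P Q dl (f : T -> R) M : tv_le P Q dl -> measurable_fun setT f ->
  0 <= M -> (forall x, `|f x| <= M) -> `|mean P f - mean Q f| <= M * dl.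
Proof.
move=> h mf; rewrite le0r => /predU1P[-> f0|M0 fM].
  have -> : f = fun=> 0.
    by apply/funext => x; apply/eqP; rewrite -normr_le0.
  by rewrite !mean_cst subrr normr0 mul0r.
have bf : bm f by split=> //; exists M.
have := h (fun x => M^-1 * f x).
rewrite !mean_scale// -mulrBr normrM gtr0_norm ?invr_gt0//.
rewrite mulrC ler_pdivrMr// mulrC; apply.
  exact: measurable_funM.
by move=> x; rewrite normrM gtr0_norm ?invr_gt0// mulrC ler_pdivrMr// mul1r.
Qed.

Lemma mean_dist P (f g : T -> R) e : bm f -> bm g -> (forall x, `|f x - g x| <= e) ->
  `|mean P f - mean P g| <= 1 * e.
Proof.
by move=> bf bg fg; rewrite mul1r -mean_sub//; apply: norm_mean_le => //;
  exact: bm_sub.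
Qed.

(** The function [(f + 1) / 2] has values in [0, 1], where [layer_cake] reduces it to events;
    undoing the rescaling gives the factor 2. *)
Lemma tv_le_sets P Q dl :
  (forall A, measurable A -> `|fine (P A) - fine (Q A)| <= dl) ->
  tv_le P Q (2 * dl).
Proof.
move=> h f mf f1.
have H : forall g : T -> R, measurable_fun setT g -> (forall x, 0 <= g x <= 1) ->
    `|mean P g - mean Q g| <= dl.
  apply: (@layer_cake R _ T _ _ 1 dl) => //.
  - by move=> *; exact: mean_sum.
  - by move=> *; exact: mean_sum.
  - by move=> *; exact: mean_scale.
  - by move=> *; exact: mean_scale.
  - by move=> *; exact: mean_dist.
  - by move=> *; exact: mean_dist.
  - by move=> A mA; rewrite !mean_indic//; exact: h.
have bf : bm f by split=> //; exists 1.
have := H (fun x => 2^-1 * (f x + 1)).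
rewrite !mean_scale ?mean_add ?mean_cst//; try by apply: bm_add.
rewrite -mulrBr opprD addrACA subrr addr0 normrM gtr0_norm ?invr_gt0//.
rewrite mulrC ler_pdivrMr// mulrC; apply.
  by apply: measurable_funM => //; exact: measurable_funD.
by move=> x; have := f1 x; rewrite ler_norml => /andP[h1 h2]; lra.
Qed.

End total_variation.

(** * Product powers *)

Section mean_image.
Context d d' (T : measurableType d) (T' : measurableType d') (R : realType).

Lemma mean_dirac (a : T) (f : T -> R) : bounded_measurable f ->
  mean (\d_a : probability T R) f = f a.
Proof.
move=> [mf _]; rewrite /mean /Rintegral integral_dirac//.
  by rewrite diracT mul1e.
exact/measurable_EFinP.
Qed.

Lemma mean_distribution (P : probability T R) (X : {mfun T >-> T'})
  (f : T' -> R) : bounded_measurable f ->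
  mean (distribution P X) f = mean P (f \o X).
Proof.
move=> bf; rewrite /mean /Rintegral integral_distribution//.
  by apply/measurable_EFinP; case: bf.
by apply: bm_integrable; exact: bm_comp bf.
Qed.

Lemma bm_mean_snd (P : probability T R) (Q : probability T' R)
    (f : T * T' -> R) :
  bounded_measurable f -> bounded_measurable (fun x => mean Q (fun y => f (x, y))).
Proof.
move=> [mf [M fM]]; have bmf : bounded_measurable f by split=> //; exists M.
have bfx x : bounded_measurable (fun y => f (x, y)).
  by split; [exact: measurableT_comp|exists M].
split; last by exists M => x; exact: norm_mean_le.
apply/measurable_EFinP.
have := measurable_fubini_F (bm_integrable (P \x Q)%E bmf).
by congr (measurable_fun _ _); apply/funext => x; rewrite /= EFin_mean.
Qed.

Lemma mean_prod (P : probability T R) (Q : probability T' R) (f : T * T' -> R) :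
  bounded_measurable f ->
  mean (P \x Q)%E f = mean P (fun x => mean Q (fun y => f (x, y))).
Proof.
move=> bf; apply: EFin_inj; rewrite EFin_mean// EFin_mean; last first.
  exact: bm_mean_snd P _ _ _.
rewrite -integral12_prod_meas1; last exact: bm_integrable.
apply: eq_integral => x _; rewrite /fubini_F EFin_mean//.
have [mf [M fM]] := bf; split; last by exists M.
exact: measurableT_comp.
Qed.

End mean_image.

Section mpow_mean.
Context d (T : measurableType d) (R : realType).
Implicit Types (mu nu : probability T R).
Local Notation bm := (@bounded_measurable _ _ R).

Definition consT n (x : T) (t : n.-tuple T) : n.+1.-tuple T := cons_pair (x, t).

Lemma bm_consT n (F : n.+1.-tuple T -> R) x : bm F -> bm (F \o consT x).
Proof.
move=> bF; apply: bm_comp bF.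
have -> : @consT n x = @cons_pair _ _ n \o pair x by [].
by apply: measurableT_comp => //; exact: measurable_cons_pair.
Qed.

Lemma mean_mpow0 mu (F : 0.-tuple T -> R) : bm F ->
  mean (mpow mu 0) F = F [tuple].
Proof. exact: mean_dirac. Qed.

Lemma bm_mpow mu n (F : n.+1.-tuple T -> R) : bm F ->
  bm (fun x => mean (mpow mu n) (F \o consT x)).
Proof.
move=> bF; apply: (bm_mean_snd mu (mpow mu n) (f := F \o @cons_pair _ _ n)).
exact: bm_comp bF.
Qed.

Lemma mean_mpowS mu n (F : n.+1.-tuple T -> R) : bm F ->
  mean (mpow mu n.+1) F = mean mu (fun x => mean (mpow mu n) (F \o consT x)).
Proof.
move=> bF; rewrite /= mean_distribution// mean_prod//.
exact: bm_comp bF.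
Qed.

Lemma bm_tnth n (h : T -> R) (i : 'I_n) : bm h ->
  bm (fun t : n.-tuple T => h (tnth t i)).
Proof. by move=> bh; apply: (bm_comp _ bh); exact: measurable_tnth. Qed.

Lemma bm_prod_tnth n (h : T -> R) : bm h ->
  bm (fun t : n.-tuple T => \prod_(i < n) h (tnth t i)).
Proof. by move=> bh; apply: bm_prod => i; exact: bm_tnth. Qed.

Lemma prod_consT n (h : T -> R) x (t : n.-tuple T) :
  \prod_(i < n.+1) h (tnth (consT x t) i) = h x * \prod_(i < n) h (tnth t i).
Proof.
rewrite big_ord_recl tnth0; congr (_ * _).
by apply: eq_bigr => i _; rewrite tnthS.
Qed.

Lemma mean_mpow_prod mu n (h : T -> R) : bm h ->
  mean (mpow mu n) (fun t => \prod_(i < n) h (tnth t i)) = mean mu h ^+ n.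
Proof.
move=> bh; elim: n => [|n IH].
  by rewrite mean_mpow0 ?big_ord0//; exact: bm_prod_tnth.
rewrite mean_mpowS; last exact: bm_prod_tnth.
transitivity (mean mu (fun x => mean mu h ^+ n * h x)); last first.
  by rewrite mean_scale// exprSr.
apply: eq_mean => x; rewrite -IH mulrC -mean_scale; last exact: bm_prod_tnth.
by apply: eq_mean => t /=; rewrite prod_consT.
Qed.

Lemma mean_mpow_map mu n (s : T -> T) : measurable_fun setT s ->
  (forall f : T -> R, bm f -> mean mu (f \o s) = mean mu f) ->
  forall F : n.-tuple T -> R, bm F ->
  mean (mpow mu n) (F \o map_tuple s) = mean (mpow mu n) F.
Proof.
move=> ms H; have mS m : measurable_fun setT (map_tuple s : m.-tuple T -> _).
  apply/measurable_fun_tnthP => i.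
  have -> : (@tnth _ _)^~ i \o map_tuple s = s \o (@tnth m T)^~ i.
    by apply/funext => t /=; rewrite tnth_map.
  by apply: measurableT_comp => //; exact: measurable_tnth.
elim: n => [|n IH] F bF.
  rewrite !mean_mpow0//; last exact: bm_comp (mS _) bF.
  by rewrite /=; congr F; apply/val_inj.
rewrite !mean_mpowS//; last exact: bm_comp (mS _) bF.
rewrite -[RHS]H; last exact: bm_mpow.
apply: eq_mean => x /=; rewrite -[RHS]IH; last exact: bm_consT.
by apply: eq_mean => t /=; congr F; apply/val_inj.
Qed.

(* Telescoping: coordinates are exchanged one at a time, the others keeping
   their share of the dominating products. *)
Lemma mpow_diff mu nu dl c (h1 h2 : T -> R) :
  tv_le mu nu dl -> bm h1 -> bm h2 ->
  (forall x, 0 <= h1 x <= 1) -> (forall x, 0 <= h2 x <= 1) ->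
  mean mu h1 <= c -> mean mu h2 <= c -> mean nu h1 <= c -> mean nu h2 <= c ->
  forall n (C1 C2 : R) (F : n.-tuple T -> R), 0 <= C1 -> 0 <= C2 -> bm F ->
  (forall t, `|F t| <= C1 * \prod_(i < n) h1 (tnth t i)
                     + C2 * \prod_(i < n) h2 (tnth t i)) ->
  `|mean (mpow mu n) F - mean (mpow nu n) F| <=
    n%:R * c ^+ n.-1 * (C1 + C2) * dl.
Proof.
move=> tv b1 b2 h1P h2P mu1 mu2 nu1 nu2.
have h10 x : 0 <= h1 x by have /andP[] := h1P x.
have h20 x : 0 <= h2 x by have /andP[] := h2P x.
have c0 : 0 <= c by rewrite (le_trans _ mu1)// mean_ge0.
have dl0 := tv_le_ge0 tv.
elim=> [|n IH] C1 C2 F C10 C20 bF FC.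
  by rewrite !mean_mpow0// subrr normr0 !mul0r.
have dom x t : `|(F \o consT x) t| <= (C1 * h1 x) * \prod_(i < n) h1 (tnth t i)
    + (C2 * h2 x) * \prod_(i < n) h2 (tnth t i).
  by have := FC (consT x t); rewrite !prod_consT !mulrA.
rewrite !mean_mpowS//.
set Gm := fun x => mean (mpow mu n) (F \o consT x).
set Gn := fun x => mean (mpow nu n) (F \o consT x).
have bGm : bm Gm by exact: bm_mpow.
have bGn : bm Gn by exact: bm_mpow.
(* The first summand exchanges the last [n] coordinates while the first stays under [mu], which is
   the induction hypothesis. The second exchanges the first coordinate once the others are under
   [nu], and needs only a uniform bound on [Gn]. *)
have -> : mean mu Gm - mean nu Gn =
    mean mu (fun x => Gm x - Gn x) + (mean mu Gn - mean nu Gn).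
  by rewrite mean_sub// addrA subrK.
have K0 : 0 <= n%:R * c ^+ n.-1 * dl by rewrite !mulr_ge0 ?exprn_ge0.
have -> : n.+1%:R * c ^+ n.+1.-1 * (C1 + C2) * dl =
    n%:R * c ^+ n * (C1 + C2) * dl + c ^+ n * (C1 + C2) * dl.
  by rewrite -natr1; ring.
apply: le_trans (ler_normD _ _) _; apply: lerD.
  pose H x := n%:R * c ^+ n.-1 * dl * (C1 * h1 x + C2 * h2 x).
  have bH : bm H by apply: bm_scale; apply: bm_add; exact: bm_scale.
  apply: (le_trans (norm_mean (g := H) mu _ bH _)).
  - exact: bm_sub.
  - move=> x; rewrite /H mulrAC.
    apply: IH => //; rewrite ?mulr_ge0//.
    exact: bm_consT.
  - rewrite mean_scale; last by apply: bm_add; exact: bm_scale.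
    rewrite mean_add; try exact: bm_scale.
    rewrite !mean_scale//.
    (* For [n = 0] the powers [c ^+ n] and [c ^+ n.-1 * c] differ, but the factor [n%:R]
       vanishes. *)
    have -> : n%:R * c ^+ n * (C1 + C2) * dl =
        n%:R * c ^+ n.-1 * dl * (C1 * c + C2 * c).
      case: (n) => [|m]; first by rewrite !mul0r.
      by rewrite /= exprSr; ring.
    by rewrite ler_wpM2l// lerD// ler_wpM2l.
apply: tv_le_scale => //; first by case: bGn.
  by rewrite mulr_ge0 ?exprn_ge0 ?addr_ge0.
move=> x; pose H (t : n.-tuple T) := (C1 * h1 x) * \prod_(i < n) h1 (tnth t i)
    + (C2 * h2 x) * \prod_(i < n) h2 (tnth t i).
have bp1 := bm_prod_tnth n b1; have bp2 := bm_prod_tnth n b2.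
have bH : bm H by apply: bm_add; exact: bm_scale.
apply: (le_trans (norm_mean (g := H) (mpow nu n) (bm_consT x bF) bH (dom x))).
rewrite mean_add; try exact: bm_scale.
rewrite !mean_scale// !mean_mpow_prod//.
have -> : c ^+ n * (C1 + C2) = C1 * c ^+ n + C2 * c ^+ n by ring.
have /andP[_ ?] := h1P x; have /andP[_ ?] := h2P x.
apply: lerD; apply: ler_pM; rewrite ?mulr_ge0 ?exprn_ge0 ?mean_ge0//.
- by rewrite ler_piMr.
- by rewrite lerXn2r ?nnegrE ?mean_ge0.
- by rewrite ler_piMr.
- by rewrite lerXn2r ?nnegrE ?mean_ge0.
Qed.

(** The indicator of the box is a product of coordinate indicators, so its mean is a power of
    [mean mu \1_A]. *)
Lemma mpow_full mu n (A : set T) : measurable A -> mu A = 1%E ->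
  measurable [set t : n.-tuple T | forall i, A (tnth t i)] /\
  mpow mu n [set t : n.-tuple T | forall i, A (tnth t i)] = 1%E.
Proof.
move=> mA muA; set B := [set t | _].
have mB : measurable B.
  have -> : B = \bigcap_(i in [set: 'I_n]) ((@tnth n T)^~ i @^-1` A).
    by apply/seteqP; split=> [t h i _|t h i]; [exact: h|exact: (h i I)].
  apply: fin_bigcap_measurable => // i _.
  rewrite -[X in measurable X]setTI.
  exact: (measurable_tnth i).
split=> //.
have fin : mpow mu n B \is a fin_num by exact: fin_num_measure.
rewrite -(fineK fin) -mean_indic//; congr EFin.
transitivity (mean (mpow mu n) (fun t => \prod_(i < n) (\1_A (tnth t i) : R))).
  apply: eq_mean => t; rewrite indicE.
  have [tB|tB] := boolP (t \in B).
    by rewrite big1// => i _; rewrite indicE mem_set//; move: tB; rewrite inE => /(_ i).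
  have : exists i, ~ A (tnth t i).
    by apply/existsNP => h; move/negP: tB; apply; rewrite inE.
  move=> [i Ai]; rewrite (bigD1 i)//= indicE memNset// mul0r//.
rewrite mean_mpow_prod; last exact: bm_indic.
by rewrite mean_indic// muA expr1n.
Qed.

End mpow_mean.

(** * Normalised tilted laws *)

Section mean_tilted.
Context d (T : measurableType d) (R : realType) (P : probability T R).
Variables (w r : {mfun T >-> R}) (lambda : R) (C : set T) (Q : probability R R).
Local Notation bm := (@bounded_measurable _ _ R).

(* The cut-off at the almost sure set [C] makes the weight bounded. *)
Definition weight (x : T) : R := \1_C x * powR00 (w x) lambda.

Hypotheses (mC : measurable C) (PC : P C = 1%E) (bw : bm weight).

Let Z := mean P weight.
Hypothesis Z0 : 0 < Z.

Local Notation eta := (mnormalize (tilted P w r lambda) Q).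

Lemma weight_ge0 x : 0 <= weight x.
Proof. by rewrite mulr_ge0// powR00_ge0. Qed.

Lemma bm_weighted (g : R -> R) : bm g -> bm (fun x => weight x * g (r x)).
Proof. by move=> bg; apply: bm_mul => //; apply: (bm_comp _ bg). Qed.

Lemma tiltedE B : measurable B ->
  tilted P w r lambda B = (mean P (fun x => weight x * \1_B (r x)))%:E.
Proof.
move=> mB; rewrite EFin_mean; last exact/bm_weighted/bm_indic.
have mB' : measurable_fun setT (fun x => \1_B (r x) : R).
  by apply: (measurableT_comp (measurable_indic mB)).
apply: ae_eq_integral => //.
- apply/measurable_EFinP; apply: measurable_funM => //.
  exact: (measurableT_comp (measurable_powR00 lambda)).
- by apply/measurable_EFinP; apply: measurable_funM => //; case: bw.
exists (~` C); split; first exact: measurableC.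
  by rewrite [LHS](probability_setC P mC) PC subee.
move=> x /= h Cx; apply: h => _; rewrite /weight (indicE _ C) mem_set//.
by rewrite mul1r.
Qed.

Lemma mnormalize_tiltedE B : measurable B ->
  fine (eta B) = mean P (fun x => weight x * \1_B (r x)) / Z.
Proof.
move=> mB; have ZE : tilted P w r lambda setT = Z%:E.
  rewrite tiltedE//; congr EFin; apply: eq_mean => x.
  by rewrite indicT mulr1.
rewrite /= /mnormalize /= [tilted _ _ _ _ setT]ZE.
rewrite eqe gt_eqF//= [tilted _ _ _ _ B]tiltedE//.
Qed.

(** On events this is [mnormalize_tiltedE]. Both sides are linear in [g] and Lipschitz for the
    uniform norm, so [layer_cake] at distance 0 extends it to functions with values in [0, 1]; the
    affine change [(g + N) / (2 N)] reduces any bounded [g] to these. *)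
Lemma mean_mnormalize_tilted (g : R -> R) : bm g ->
  mean eta g = mean P (fun x => weight x * g (r x)) / Z.
Proof.
have H01 (h : R -> R) : measurable_fun setT h -> (forall x, 0 <= h x <= 1) ->
    mean eta h = mean P (fun x => weight x * h (r x)) / Z.
  move=> mh h01; apply/eqP; rewrite -subr_eq0 -normr_le0.
  pose L h := mean P (fun x => weight x * h (r x)) / Z.
  move: h mh h01.
  apply: (@layer_cake R _ _ (mean eta) L 1 0) => //.
  - by move=> *; exact: mean_sum.
  - move=> J F bF; rewrite /L -mulr_suml -mean_sum; last first.
      by move=> j; exact: bm_weighted.
    by congr (_ / _); apply: eq_mean => x; rewrite mulr_sumr.
  - by move=> *; exact: mean_scale.
  - move=> c f bf; rewrite /L mulrA -mean_scale; last exact: bm_weighted.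
    by congr (_ / _); apply: eq_mean => x; rewrite mulrCA.
  - by move=> *; exact: mean_dist.
  - move=> f f1 e bf bg fge; rewrite /L -mulrBl normrM.
    rewrite (gtr0_norm (x := Z^-1)) ?invr_gt0//.
    rewrite ler_pdivrMr// mul1r -mean_sub; try exact: bm_weighted.
    rewrite -mean_scale//; apply: norm_mean.
    + by apply: bm_sub; exact: bm_weighted.
    + exact: bm_scale.
    + move=> x; rewrite -mulrBr normrM ger0_norm ?weight_ge0// mulrC.
      by rewrite ler_wpM2r ?weight_ge0.
  - by move=> A mA; rewrite mean_indic// mnormalize_tiltedE// subrr normr0.
move=> bg; have [mg [M gM]] := bg.
pose N := `|M| + 1; have N0 : 0 < N by rewrite ltr_wpDl.
have gN x : `|g x| <= N by rewrite (le_trans (gM x))// (le_trans (ler_norm M))// lerDl.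
have bh : bm (fun x => g x + N) by exact: bm_add.
have c0 : (2 * N)^-1 != 0 by rewrite gt_eqF// invr_gt0 mulr_gt0.
have := H01 (fun x => (2 * N)^-1 * (g x + N)).
rewrite mean_scale// mean_add// mean_cst.
have -> : mean P (fun x => weight x * ((2 * N)^-1 * (g (r x) + N))) =
    (2 * N)^-1 * (mean P (fun x => weight x * g (r x)) + N * Z).
  rewrite -mean_scale// -mean_add; [|exact: bm_weighted|exact: bm_scale].
  rewrite -mean_scale; last by apply: bm_add; [exact: bm_weighted|exact: bm_scale].
  by apply: eq_mean => x; ring.
rewrite -(mulrA _ _ Z^-1) (mulrDl _ (N * Z) Z^-1) mulfK ?gt_eqF// => H.
suff /(mulfI c0)/addIr : (2 * N)^-1 * (mean eta g + N) =
  (2 * N)^-1 * (mean P (fun x => weight x * g (r x)) / Z + N) by [].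
apply: H.
  by apply: measurable_funM => //; exact: measurable_funD.
move=> x; have := gN x; rewrite ler_norml => /andP[h1 h2].
apply/andP; split; last by rewrite mulrC ler_pdivrMr ?mulr_gt0//; lra.
by apply: mulr_ge0; [rewrite invr_ge0; lra|lra].
Qed.

(** Inserting [\1_A] leaves the means unchanged. On [A] the factor [\1_B (r x)] is 1 wherever the
    weight can be nonzero, so numerator and normaliser agree. *)
Lemma mnormalize_tilted_full (A : set T) (B : set R) :
  measurable A -> P A = 1%E -> measurable B ->
  (forall x, A x -> C x -> B (r x)) -> eta B = 1%E.
Proof.
move=> mA PA mB AB; have bB : bm (\1_B : R -> R) by exact: bm_indic.
rewrite -(fineK (fin_num_measure eta B mB)) -mean_indic// mean_mnormalize_tilted//.
rewrite -(mean_indicM mA PA); last exact: (bm_weighted (g := \1_B)).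
suff -> : mean P (fun x => \1_A x * (weight x * \1_B (r x))) = Z.
  by rewrite divff// gt_eqF.
rewrite -[RHS](mean_indicM mA PA)//; apply: eq_mean => x.
have [xA|xA] := pselect (A x); last by rewrite indicE memNset// !mul0r.
have [xC|xC] := pselect (C x); last first.
  by rewrite /weight (indicE _ C) memNset// !mul0r.
by rewrite (indicE _ B) mem_set ?mulr1//; exact: AB.
Qed.

End mean_tilted.

(** * Symmetric laws on the unit interval *)

Section symmetric_laws.
Context (R : realType).
Implicit Types (mu nu : probability R R) (f g : R -> R).

Definition symmetric01 mu : Prop := mu `[0, 1]%classic = 1%E /\
  forall f, bounded_measurable f -> mean mu (fun x => f (1 - x)) = mean mu f.

Definition interior_mass mu : R := mean mu \1_(`]0, 1[%classic).

Lemma indic_itvE (i : interval R) x : \1_[set` i] x = (x \in i)%:R :> R.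
Proof. by rewrite indicE mem_setE. Qed.

Lemma indic_set1E (a x : R) : \1_[set a] x = (x == a)%:R :> R.
Proof. by rewrite indicE; congr (nat_of_bool _)%:R; apply/idP/eqP; rewrite inE. Qed.

Lemma bm_indic_itv (i : interval R) : bounded_measurable (\1_[set` i] : R -> R).
Proof. by apply: bm_indic. Qed.

Lemma bm_flip f : bounded_measurable f ->
  bounded_measurable (fun x : R => f (1 - x)).
Proof. by move=> bf; apply: (bm_comp _ bf); exact: measurable_funB. Qed.

Lemma mean_itv01 mu : symmetric01 mu -> mean mu \1_(`[0, 1]%classic) = 1.
Proof. by move=> [h _]; rewrite mean_indic// h. Qed.

Lemma flip_oc (x : R) : (1 - x \in `]0, 1]) = (x \in `[0, 1[).
Proof. by rewrite !in_itv /=; apply/idP/idP => /andP[? ?]; apply/andP; split; lra. Qed.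

Lemma flip_oo (x : R) : (1 - x \in `]0, 1[) = (x \in `]0, 1[).
Proof. by rewrite !in_itv /=; apply/idP/idP => /andP[? ?]; apply/andP; split; lra. Qed.

Lemma mean_itv_co mu : symmetric01 mu ->
  mean mu \1_(`[0, 1[%classic) = mean mu \1_(`]0, 1]%classic).
Proof.
move=> [_ sym]; rewrite -sym; last exact: bm_indic_itv.
by apply: eq_mean => x; rewrite !indic_itvE -flip_oc subKr.
Qed.

(** The indicators of (0,1] and [0,1) add up to those of [0,1] and (0,1), and by symmetry the first
    two have equal means. *)
Lemma mean_itv_oc mu : symmetric01 mu ->
  mean mu \1_(`]0, 1]%classic) = (1 + interior_mass mu) / 2.
Proof.
move=> smu; have h := mean_itv_co smu.
have : mean mu (fun x => \1_(`]0, 1]%classic) x + \1_(`[0, 1[%classic) x) =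
    mean mu (fun x => \1_(`[0, 1]%classic) x + \1_(`]0, 1[%classic) x).
  apply: eq_mean => x; rewrite !indic_itvE !in_itv /=.
  by have [x0|x0|x0] := ltgtP 0 x; have [x1|x1|x1] := ltgtP x 1;
     rewrite /= ?addr0 ?add0r//; lra.
rewrite !mean_add; try exact: bm_indic_itv.
rewrite h mean_itv01// /interior_mass.
by move=> H; apply: (@mulIf _ 2) => //; rewrite mulfVK//; lra.
Qed.

Lemma mean_atom0 mu : symmetric01 mu ->
  mean mu \1_[set 0] = (1 - interior_mass mu) / 2.
Proof.
move=> smu; have := mean_itv_co smu; rewrite mean_itv_oc//.
have -> : mean mu \1_(`[0, 1[%classic) =
    mean mu (fun x => \1_[set 0] x + \1_(`]0, 1[%classic) x).
  apply: eq_mean => x; rewrite !indic_itvE indic_set1E !in_itv /=.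
  have [x0|x0|x0] := ltgtP x 0; rewrite ?add0r ?addr0//.
  by rewrite x0 ltr01.
rewrite mean_add; [|exact: bm_indic|exact: bm_indic_itv].
by rewrite -/(interior_mass mu); lra.
Qed.

Lemma interior_mass01 mu : 0 <= interior_mass mu <= 1.
Proof.
rewrite mean_ge0//= -(mean_cst mu 1); apply: le_mean => //.
exact: bm_indic_itv.
Qed.

End symmetric_laws.

Section cube.
Context (R : realType) (n : nat).
Implicit Types (mu : probability R R) (t : n.-tuple R).

Definition cube : set (n.-tuple R) :=
  [set t | forall i, `[0, 1]%classic (tnth t i)].

Lemma cubeP t : cube t <-> forall i, 0 <= tnth t i <= 1.
Proof. by split=> h i; have := h i; rewrite /= in_itv. Qed.

Lemma measurable_cube mu : symmetric01 mu -> measurable cube.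
Proof. by move=> [h _]; have [] := mpow_full n _ h. Qed.

Lemma mpow_cube mu : symmetric01 mu -> mpow mu n cube = 1%E.
Proof. by move=> [h _]; have [] := mpow_full n _ h. Qed.

Definition flip t : n.-tuple R := map_tuple (fun x => 1 - x) t.

Lemma tnth_flip t i : tnth (flip t) i = 1 - tnth t i.
Proof. exact: tnth_map. Qed.

Lemma mean_flip mu (F : n.-tuple R -> R) : symmetric01 mu ->
  bounded_measurable F -> mean (mpow mu n) (F \o flip) = mean (mpow mu n) F.
Proof.
move=> [_ sym] bF; apply: mean_mpow_map => //.
exact: measurable_funB.
Qed.

Lemma cube_flip t : cube (flip t) <-> cube t.
Proof.
by rewrite !cubeP; split=> h i; have := h i; rewrite tnth_flip => /andP[? ?];
  apply/andP; split; lra.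
Qed.

Lemma prodt_flip t : prodt (flip t) = prodtC t.
Proof. by apply: eq_bigr => i _; rewrite tnth_flip. Qed.

Lemma prodtC_flip t : prodtC (flip t) = prodt t.
Proof. by apply: eq_bigr => i _; rewrite tnth_flip subKr. Qed.

Lemma prodt_ge0 t : cube t -> 0 <= prodt t.
Proof. by move=> /cubeP h; apply: prodr_ge0 => i _; case/andP: (h i). Qed.

Lemma prodtC_ge0 t : cube t -> 0 <= prodtC t.
Proof. by rewrite -prodt_flip -cube_flip; exact: prodt_ge0. Qed.

Lemma prodt_le t i : cube t -> prodt t <= tnth t i.
Proof.
move=> /cubeP h; rewrite /prodt (bigD1 i)//= ler_piMr//.
  by case/andP: (h i).
by apply: prodr_ile1 => j _.
Qed.

Lemma prodtC_le t i : cube t -> prodtC t <= 1 - tnth t i.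
Proof. by rewrite -prodt_flip -tnth_flip -cube_flip; exact: prodt_le. Qed.

Lemma dot_weight_le1 t : (0 < n)%N -> cube t -> dot_weight t <= 1.
Proof.
move=> n0 tc; have := prodt_le (Ordinal n0) tc; have := prodtC_le (Ordinal n0) tc.
by rewrite /dot_weight; lra.
Qed.

Lemma dot_weight_ge0 t : cube t -> 0 <= dot_weight t.
Proof. by move=> tc; rewrite addr_ge0 ?prodt_ge0 ?prodtC_ge0. Qed.

Lemma hat_weightE t : hat_weight t = 2 - dot_weight t.
Proof. by rewrite /hat_weight /dot_weight opprD addrA. Qed.

Lemma dot_weight_flip t : dot_weight (flip t) = dot_weight t.
Proof. by rewrite /dot_weight prodt_flip prodtC_flip addrC. Qed.

Lemma hat_weight_flip t : hat_weight (flip t) = hat_weight t.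
Proof. by rewrite !hat_weightE dot_weight_flip. Qed.

Lemma prod_indic_itv (i : interval R) t :
  \prod_(j < n) (\1_[set` i] (tnth t j) : R) = [forall j, tnth t j \in i]%:R.
Proof.
have [/forallP h|/forallPn[j hj]] := boolP [forall j, tnth t j \in i].
  by rewrite big1// => j _; rewrite indic_itvE h.
by rewrite (bigD1 j)//= indic_itvE (negbTE hj) mul0r.
Qed.

Lemma prodt_neq0 t : cube t -> (prodt t != 0) = [forall j, tnth t j \in `]0, 1]].
Proof.
move=> /cubeP tc; apply/idP/forallP => [/prodf_neq0 h j|h].
  by have /andP[t0 t1] := tc j; rewrite in_itv /= t1 andbT lt_neqAle eq_sym h.
by apply/prodf_neq0 => j _; have := h j; rewrite in_itv /= => /andP[/gt_eqF->].
Qed.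

Lemma prodtC_neq0 t : cube t -> (prodtC t != 0) = [forall j, tnth t j \in `[0, 1[].
Proof.
rewrite -cube_flip -prodt_flip => /prodt_neq0 ->.
by apply: eq_forallb => j; rewrite tnth_flip flip_oc.
Qed.

Lemma dot_ratio01 t : cube t -> 0 <= dot_ratio t <= 1.
Proof.
move=> tc; have p0 := prodt_ge0 tc; have q0 := prodtC_ge0 tc.
(* If both products vanish, the quotient by 0 takes the value 0, which still lies in [0, 1]. *)
have := dot_weight_ge0 tc; rewrite /dot_ratio le0r => /predU1P[->|w0].
  by rewrite invr0 mulr0 lexx ler01.
rewrite divr_ge0 ?(ltW w0)//= ler_pdivrMr// mul1r /dot_weight; lra.
Qed.

Lemma dot_ratio_flip t : dot_weight t != 0 ->
  dot_ratio (flip t) = 1 - dot_ratio t.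
Proof.
move=> w0; rewrite /dot_ratio dot_weight_flip prodt_flip.
by rewrite -[in RHS](divff w0) -mulrBl /dot_weight [_ + prodtC t]addrC addrK.
Qed.

Lemma hat_weight_ge1 t : (0 < n)%N -> cube t -> 1 <= hat_weight t.
Proof. by move=> n0 tc; rewrite hat_weightE; have := dot_weight_le1 n0 tc; lra. Qed.

Lemma hat_weight_le2 t : cube t -> hat_weight t <= 2.
Proof. by move=> tc; rewrite hat_weightE; have := dot_weight_ge0 tc; lra. Qed.

Lemma hat_ratio01 t : (0 < n)%N -> cube t -> 0 <= hat_ratio t <= 1.
Proof.
move=> n0 tc; have w1 := hat_weight_ge1 n0 tc.
have := prodt_le (Ordinal n0) tc; have := prodtC_le (Ordinal n0) tc.
have /cubeP/(_ (Ordinal n0))/andP[t0 t1] := tc.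
have p0 := prodt_ge0 tc; have q0 := prodtC_ge0 tc => h1 h2.
have w0 : 0 < hat_weight t by lra.
rewrite /hat_ratio divr_ge0 ?(ltW w0)//=; last by lra.
by rewrite ler_pdivrMr// mul1r /hat_weight; lra.
Qed.

Lemma hat_ratio_flip t : hat_weight t != 0 ->
  hat_ratio (flip t) = 1 - hat_ratio t.
Proof.
move=> w0; rewrite /hat_ratio hat_weight_flip prodt_flip.
apply: (mulIf w0); rewrite mulfVK// mulrBl mul1r mulfVK//.
by rewrite /hat_weight; lra.
Qed.

End cube.

(** * The first map *)

Section powR_bounds.
Context (R : realType) (l : R).
Hypothesis l01 : 0 <= l <= 1.

Let l0 : 0 <= l. Proof. by case/andP: l01. Qed.
Let l1 : l <= 1. Proof. by case/andP: l01. Qed.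

Lemma powR_le1 (x : R) : 0 <= x <= 1 -> x `^ l <= 1.
Proof.
move=> /andP[x0 x1]; have <- : 1 `^ l = 1 :> R by rewrite powR1.
by rewrite ge0_ler_powR// nnegrE.
Qed.

Lemma powR2_le2 : (2 : R) `^ l <= 2.
Proof. by rewrite -[leRHS](powRr1 (ler0n _ 2)) ler_powR// ler1n. Qed.

(** The shares x/(x+y) and y/(x+y) lie in (0, 1], so each is at most its own [l]-th power, and they
    add up to 1. *)
Lemma powR_add_le (x y : R) : 0 < x -> 0 < y ->
  (x + y) `^ l <= x `^ l + y `^ l.
Proof.
move=> x0 y0; have s0 : 0 < x + y by rewrite addr_gt0.
have H (z : R) : 0 < z -> z <= x + y -> z / (x + y) * (x + y) `^ l <= z `^ l.
  move=> z0 zs; have -> : z `^ l = (z / (x + y)) `^ l * (x + y) `^ l.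
    by rewrite -powRM ?divfK ?gt_eqF ?divr_ge0 ?ltW.
  rewrite ler_wpM2r ?powR_ge0// ger1_powR//.
  by rewrite divr_gt0//= ler_pdivrMr// mul1r.
have -> : (x + y) `^ l =
    x / (x + y) * (x + y) `^ l + y / (x + y) * (x + y) `^ l.
  by rewrite -!mulrDl divff ?mul1r// gt_eqF.
by apply: lerD; apply: H => //; rewrite ?lerDl ?lerDr ltW.
Qed.

(** Weighted AM-GM for t and 1. With s the right-hand side, [ln z <= z - 1] is applied at t/s and
    1/s with weights [l] and [1 - l]; the upper bounds average to 0. *)
Lemma powR_le_tangent (t : R) : 0 < t -> t `^ l <= 1 + l * (t - 1).
Proof.
move=> t0; have s0 : 0 < 1 + l * (t - 1).
  have -> : 1 + l * (t - 1) = (1 - l) + l * t by ring.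
  have [->|ln0] := eqVneq l 0; first by rewrite mul0r addr0 subr0.
  by rewrite ltr_wpDl ?subr_ge0// mulr_gt0// lt_neqAle eq_sym ln0.
set s := 1 + l * (t - 1) in s0 *.
have lnle (z : R) : 0 < z -> ln z <= z - 1.
  move=> z0; have := @le_ln1Dx R (z - 1); have -> : 1 + (z - 1) = z by ring.
  by apply; lra.
have h1 : ln t - ln s <= t / s - 1 by rewrite -ln_div ?posrE// lnle// divr_gt0.
have h2 : - ln s <= s^-1 - 1 by rewrite -lnV ?posrE// lnle// invr_gt0.
rewrite /powR gt_eqF// -[leRHS](lnK s0) ler_expR.
have : l * (ln t - ln s) + (1 - l) * (- ln s) <= l * (t / s - 1) + (1 - l) * (s^-1 - 1).
  by apply: lerD; apply: ler_wpM2l; rewrite ?subr_ge0.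
have -> : l * (t / s - 1) + (1 - l) * (s^-1 - 1) = 0.
  transitivity (s / s - 1); first by rewrite {3}/s; ring.
  by rewrite divff ?gt_eqF// subrr.
by lra.
Qed.

(** Concavity: both powers lie below the tangent at 1/2, whose linear terms at [y] and [1 - y]
    cancel. *)
Lemma powR_flip_le (y : R) : 0 < y < 1 ->
  y `^ l + (1 - y) `^ l <= 2 * 2^-1 `^ l.
Proof.
move=> /andP[y0 y1].
have H (z : R) : 0 < z -> z `^ l <= 2^-1 `^ l * (1 + l * (2 * z - 1)).
  move=> z0; have -> : z `^ l = 2^-1 `^ l * (2 * z) `^ l.
    by rewrite -powRM ?invr_ge0 ?mulr_ge0// ?ltW// mulKf.
  by rewrite ler_wpM2l ?powR_ge0// powR_le_tangent// mulr_gt0.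
apply: le_trans (lerD (H _ y0) (H (1 - y) _)) _; first by rewrite subr_gt0.
by rewrite -mulrDr mulrC ler_wpM2r ?powR_ge0//; lra.
Qed.

Lemma powR_prod (n : nat) (x : 'I_n -> R) : (forall i, 0 <= x i) ->
  (\prod_(i < n) x i) `^ l = \prod_(i < n) (x i) `^ l.
Proof.
elim: n x => [|n IH] x x0; first by rewrite !big_ord0 powR1.
by rewrite !big_ord_recl powRM ?IH// prodr_ge0.
Qed.

End powR_bounds.

Section hat_step.
Context (R : realType) (n : nat) (l : R).
Hypotheses (n0 : (0 < n)%N) (l01 : 0 <= l <= 1).
Implicit Types (mu nu : probability R R) (g : R -> R).

Local Notation W := (weight (@hat_weight R n) l (@cube R n)).
Local Notation hat mu := (hatR n.+1 l mu).
Local Notation hl := (2 `^ l : R).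

Let l0 : 0 <= l. Proof. by case/andP: l01. Qed.

Lemma hatWE t : cube t -> W t = hat_weight t `^ l.
Proof.
move=> tc; rewrite /weight indicE mem_set// mul1r /powR00 /= gt_eqF//.
exact: lt_le_trans (hat_weight_ge1 n0 tc).
Qed.

Lemma hatW_out t : ~ cube t -> W t = 0.
Proof. by move=> tc; rewrite /weight indicE memNset// mul0r. Qed.

Lemma hatW_ge0 t : 0 <= W t.
Proof. by rewrite mulr_ge0// powR00_ge0. Qed.

Lemma hatW_ge1 t : cube t -> 1 <= W t.
Proof.
move=> tc; rewrite hatWE// -[leLHS](powRr0 (hat_weight t)).
by rewrite ler_powR// hat_weight_ge1.
Qed.

Lemma hatW_le t : W t <= hl.
Proof.
have [tc|tc] := pselect (cube t); last by rewrite hatW_out// powR_ge0.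
have w1 := hat_weight_ge1 n0 tc; rewrite hatWE//.
have w2 := hat_weight_le2 tc.
by apply: ge0_ler_powR => //; rewrite nnegrE// (le_trans ler01).
Qed.

Lemma bm_hatW mu : symmetric01 mu -> bounded_measurable W.
Proof.
move=> smu; split; last first.
  by exists hl => t; rewrite ger0_norm ?hatW_ge0 ?hatW_le.
apply: measurable_funM; first by apply: measurable_indic; exact: measurable_cube smu.
exact: (measurableT_comp (measurable_powR00 l)).
Qed.

Lemma bm_hatWg mu g : symmetric01 mu -> bounded_measurable g ->
  bounded_measurable (fun t => W t * g (hat_ratio t)).
Proof. by move=> smu bg; exact: (bm_weighted (@hat_ratio R n) (bm_hatW smu)). Qed.

Section one_law.
Context mu (smu : symmetric01 mu).
Local Notation P := (mpow mu n).

Let bW := bm_hatW smu.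
Let mC : measurable (@cube R n) := measurable_cube smu.
Let PC : P (@cube R n) = 1%E := mpow_cube n smu.

Lemma hatZ_ge1 : 1 <= mean P W.
Proof.
rewrite -(mean_cst P 1) -(mean_indicM mC PC (f := fun=> 1))//.
apply: le_mean => //; first by apply: bm_mul => //; exact: bm_indic.
move=> t; rewrite mulr1 indicE; have [tc|tc] := boolP (t \in _).
  by apply: hatW_ge1; rewrite inE in tc.
exact: hatW_ge0.
Qed.

Lemma hatZ_le : mean P W <= hl.
Proof. by rewrite -(mean_cst P hl) le_mean// => t; exact: hatW_le. Qed.

Let Z0 : 0 < mean P W. Proof. by have := hatZ_ge1; lra. Qed.

Lemma mean_hat g : bounded_measurable g ->
  mean (hat mu) g = mean P (fun t => W t * g (hat_ratio t)) / mean P W.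
Proof. exact: mean_mnormalize_tilted. Qed.

Lemma hat_image (A B : set R) : measurable A -> mu A = 1%E -> measurable B ->
  (forall t : n.-tuple R, (forall i, A (tnth t i)) -> cube t -> B (hat_ratio t)) ->
  hat mu B = 1%E.
Proof.
move=> mA muA mB AB; have [mAn PAn] := mpow_full n mA muA.
exact: (mnormalize_tilted_full _ mC PC bW Z0 mAn PAn).
Qed.

Lemma symmetric_hat : symmetric01 (hat mu).
Proof.
split.
  apply: (@hat_image `[0, 1]%classic) => //; first by case: smu.
  by move=> t _ tc; rewrite /= in_itv /= hat_ratio01.
move=> f bf; rewrite !mean_hat//; last exact: bm_flip.
congr (_ / _); rewrite -(mean_flip smu); last exact: bm_hatWg smu (bm_flip bf).
apply: eq_mean => t /=.
have [tc|tc] := pselect (cube t); last first.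
  by rewrite !hatW_out ?mul0r// cube_flip.
have w0 : hat_weight t != 0 by rewrite gt_eqF//; have := hat_weight_ge1 n0 tc; lra.
rewrite !hatWE ?hat_weight_flip ?hat_ratio_flip ?subKr//.
exact/cube_flip.
Qed.

(** Inputs all equal to 0 give ratio 1 and weight 1. This event has probability ((1 - eps)/2)^n, and
    the normaliser is at most 2^l. *)
Lemma hat_atom1 :
  ((1 - interior_mass mu) / 2) ^+ n / hl <= mean (hat mu) \1_[set 1].
Proof.
have b0 : bounded_measurable (\1_[set 0] : R -> R) by exact: bm_indic.
have b1 : bounded_measurable (\1_[set 1] : R -> R) by exact: bm_indic.
rewrite mean_hat// -mean_atom0// -mean_mpow_prod//.
apply: ler_pM.
- apply: mean_ge0 => t; apply: prodr_ge0 => i _.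
  by rewrite indic_set1E ler0n.
- by rewrite invr_ge0 powR_ge0.
- apply: le_mean; first exact: bm_prod_tnth.
    exact: (bm_hatWg (g := \1_[set 1]) smu).
  move=> t.
  have [/forallP h|/forallPn[i ti]] := boolP [forall i, tnth t i == 0]; last first.
    by rewrite (bigD1 i)//= indic_set1E (negbTE ti) mul0r mulr_ge0 ?hatW_ge0.
  have tc : cube t by apply/cubeP => i; rewrite (eqP (h i)) lexx ler01.
  rewrite big1; last by move=> i _; rewrite indic_set1E h.
  have pt : prodt t = 0.
    by apply/eqP; rewrite /prodt prodf_seq_eq0; apply/hasP;
      exists (Ordinal n0) => //=; exact: mem_index_enum.
  have qt : prodtC t = 1 by rewrite /prodtC big1// => i _; rewrite (eqP (h i)) subr0.
  have wt : hat_weight t = 1 by rewrite /hat_weight pt qt; lra.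
  have rt : hat_ratio t = 1 by rewrite /hat_ratio wt pt subr0 divr1.
  by rewrite hatWE// wt powR1 rt indic_set1E eqxx mulr1.
- by rewrite lef_pV2 ?posrE ?hatZ_le ?powR_gt0.
Qed.

End one_law.

Local Notation h1 := (\1_(`]0, 1]%classic) : R -> R).
Local Notation h2 := (\1_(`[0, 1[%classic) : R -> R).

(* [hat_ratio] is 1/2, with weight [2 ^ l], unless all coordinates are nonzero
   or all coordinates differ from 1. *)
Lemma hat_dev g t : (forall x, `|g x| <= 1) ->
  `|W t * g (hat_ratio t) - hl * g 2^-1 * \1_(@cube R n) t| <=
  4 * \prod_(i < n) h1 (tnth t i) + 4 * \prod_(i < n) h2 (tnth t i).
Proof.
move=> g1; rewrite !prod_indic_itv.
have [tc|tc] := pselect (cube t); last first.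
  by rewrite hatW_out// indicE memNset// mulr0 mul0r subrr normr0 addr_ge0 ?mulr_ge0.
rewrite indicE mem_set// mulr1 -prodt_neq0// -prodtC_neq0//.
have [pt|pt] := eqVneq (prodt t) 0; have [qt|qt] := eqVneq (prodtC t) 0.
- have wt : hat_weight t = 2 by rewrite /hat_weight pt qt !subr0.
  have -> : hat_ratio t = 2^-1 by rewrite /hat_ratio wt pt subr0 mul1r.
  by rewrite hatWE// wt subrr normr0 !mulr0 addr0.
all: apply: (@le_trans _ _ 4); last by rewrite /= ?mulr1 ?mulr0 ?add0r ?addr0// lerDl.
all: have h : `|W t * g (hat_ratio t)| <= 2 * 1.
all: try by rewrite normrM ler_pM// ger0_norm ?hatW_ge0//
  (le_trans (hatW_le t))// powR2_le2.
all: have h' : `|hl * g 2^-1| <= 2 * 1.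
all: try by rewrite normrM ler_pM// ger0_norm ?powR_ge0// powR2_le2.
all: by rewrite (le_trans (ler_normB _ _))//; lra.
Qed.

(** An output other than 1/2 requires all inputs nonzero or all different from 1. Each of these
    events has probability ((1 + eps)/2)^n and weight at most 2, which gives 4 in total, and the
    normaliser is at least 1. *)
Lemma hat_atom_half mu : symmetric01 mu ->
  1 - 4 * ((1 + interior_mass mu) / 2) ^+ n <= mean (hat mu) \1_[set 2^-1].
Proof.
move=> smu; pose g (x : R) : R := 1 - \1_[set 2^-1] x.
have b1 : bounded_measurable (\1_[set 2^-1] : R -> R) by exact: bm_indic.
have bg : bounded_measurable g by exact: bm_sub.
have bp (i : interval R) := bm_prod_tnth n (bm_indic_itv i).
suff : mean (hat mu) g <= 4 * ((1 + interior_mass mu) / 2) ^+ n.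
  by rewrite mean_sub// mean_cst; lra.
rewrite mean_hat//; have Z1 := hatZ_ge1 smu.
rewrite ler_pdivrMr; last by lra.
apply: (@le_trans _ _ (4 * ((1 + interior_mass mu) / 2) ^+ n)); last first.
  rewrite ler_peMr//= mulr_ge0//= exprn_ge0//.
  by have /andP[? _] := interior_mass01 mu; lra.
have -> : 4 * ((1 + interior_mass mu) / 2) ^+ n =
    mean (mpow mu n) (fun t => 2 * \prod_(i < n) h1 (tnth t i)
       + 2 * \prod_(i < n) h2 (tnth t i)).
  rewrite mean_add; try exact: bm_scale.
  rewrite !mean_scale// !mean_mpow_prod; try exact: bm_indic_itv.
  by rewrite mean_itv_co// mean_itv_oc//; lra.
apply: le_mean.
- exact: (bm_hatWg (g := g) smu).
- by apply: bm_add; exact: bm_scale.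
move=> t; rewrite !prod_indic_itv.
have [tc|tc] := pselect (cube t); last first.
  by rewrite hatW_out// mul0r addr_ge0 ?mulr_ge0.
rewrite -prodt_neq0// -prodtC_neq0//.
have [pt|pt] := eqVneq (prodt t) 0; have [qt|qt] := eqVneq (prodtC t) 0.
- have wt : hat_weight t = 2 by rewrite /hat_weight pt qt !subr0.
  have -> : hat_ratio t = 2^-1 by rewrite /hat_ratio wt pt subr0 mul1r.
  by rewrite /g indic_set1E eqxx subrr mulr0 /= !mulr0 addr0.
all: apply: (@le_trans _ _ (2 * 1));
  last by rewrite /= ?mulr1 ?mulr0 ?add0r ?addr0// lerDl.
all: apply: ler_pM; rewrite ?hatW_ge0 ?(le_trans (hatW_le t)) ?powR2_le2//.
all: by rewrite /g indic_set1E; case: (_ == _); rewrite ?subrr ?subr0.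
Qed.

(** The main term [hl * g 2^-1] is the same under both laws, so only the deviation [F g] is
    exchanged; its domination in [hat_dev] brings in the small factor [q ^+ n.-1]. The numerator and
    the normaliser each contribute 4 + 4, hence 16. *)
Lemma tv_le_hat mu nu q dl : symmetric01 mu -> symmetric01 nu ->
  (1 + interior_mass mu) / 2 <= q -> (1 + interior_mass nu) / 2 <= q ->
  tv_le mu nu dl ->
  tv_le (hat mu) (hat nu) (16 * (n%:R * q ^+ n.-1) * dl).
Proof.
move=> smu snu qmu qnu tv.
pose F g t : R := W t * g (hat_ratio t) - hl * g 2^-1 * \1_(@cube R n) t.
have b1 : bounded_measurable h1 by exact: bm_indic_itv.
have b2 : bounded_measurable h2 by exact: bm_indic_itv.
have bW := bm_hatW smu; have mC : measurable (@cube R n) := measurable_cube smu.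
have bWg := fun g => @bm_hatWg mu g smu.
have bF g : bounded_measurable g -> bounded_measurable (F g).
  by move=> bg; apply: bm_sub; [exact: (bWg g bg)|by apply: bm_scale; exact: bm_indic].
have hP (i : interval R) x : 0 <= (\1_[set` i] x : R) <= 1.
  by rewrite indic_itvE; case: (_ \in _); rewrite /= ?lexx ?ler01.
have mF pi g : symmetric01 pi -> bounded_measurable g -> mean (mpow pi n) (F g) =
    mean (mpow pi n) (fun t => W t * g (hat_ratio t)) - hl * g 2^-1.
  move=> spi bg; rewrite mean_sub; [|exact: bWg|by apply: bm_scale; exact: bm_indic].
  rewrite mean_scale; last exact: bm_indic.
  by rewrite mean_indic// mpow_cube//= mulr1.
have dl0 := tv_le_ge0 tv.
set e := n%:R * q ^+ n.-1 * (4 + 4) * dl.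
have D g : measurable_fun setT g -> (forall x, `|g x| <= 1) ->
    `|mean (mpow mu n) (fun t => W t * g (hat_ratio t))
      - mean (mpow nu n) (fun t => W t * g (hat_ratio t))| <= e.
  move=> mg g1; have bg : bounded_measurable g by split=> //; exists 1.
  have -> : mean (mpow mu n) (fun t => W t * g (hat_ratio t))
      - mean (mpow nu n) (fun t => W t * g (hat_ratio t)) =
      mean (mpow mu n) (F g) - mean (mpow nu n) (F g).
    by rewrite !mF//; lra.
  apply: (mpow_diff tv b1 b2) => //; rewrite ?mean_itv_co ?mean_itv_oc//.
  - exact: bF.
  - by move=> t; exact: hat_dev.
move=> g mg g1; have bg : bounded_measurable g by split=> //; exists 1.
have /= Dg := D g mg g1.
have : `|mean (mpow mu n) (fun t => W t * 1)
    - mean (mpow nu n) (fun t => W t * 1)| <= e.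
  by apply: (D (fun=> 1)) => // x; rewrite normr1.
have -> : (fun t => W t * 1) = W by apply/funext => t; rewrite mulr1.
rewrite !mean_hat//; have Z1 := hatZ_ge1 smu; have Z1' := hatZ_ge1 snu.
move: Dg; set a := mean _ _; set b := mean _ _; set Zm := mean _ _; set Zn := mean _ _.
move=> ab ZZ.
have Zm0 : 0 < Zm by rewrite (lt_le_trans ltr01).
have Zn0 : 0 < Zn by rewrite (lt_le_trans ltr01).
have bZ : `|b / Zn| <= 1.
  rewrite normrM (ger0_norm (x := Zn^-1)) ?invr_ge0 ?(ltW Zn0)// ler_pdivrMr// mul1r.
  apply: norm_mean => //; first exact: (bWg g bg).
  by move=> t; rewrite normrM ger0_norm ?hatW_ge0// ler_piMr ?hatW_ge0.
(* In this form both differences are at most [e], the quotient [b / Zn] is at most 1 in modulus, and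
   division by [Zm >= 1] does no harm. *)
have -> : a / Zm - b / Zn = (a - b) / Zm - (b / Zn) * (Zm - Zn) / Zm.
  by field; rewrite !gt_eqF.
have e0 : 0 <= e by apply: le_trans ab.
have -> : 16 * (n%:R * q ^+ n.-1) * dl = e + e by rewrite /e; ring.
apply: le_trans (ler_normB _ _) _; apply: lerD.
  rewrite normrM (ger0_norm (x := Zm^-1)) ?invr_ge0 ?(ltW Zm0)// ler_pdivrMr//.
  by rewrite (le_trans ab)// ler_peMr.
rewrite normrM (ger0_norm (x := Zm^-1)) ?invr_ge0 ?(ltW Zm0)// ler_pdivrMr// normrM.
apply: (@le_trans _ _ (1 * e)); first exact: ler_pM.
by rewrite mul1r ler_peMr.
Qed.

End hat_step.

(** * The second map *)

(** The arithmetic of [tv_le_dot]. There [H] is s^n, [A] is a^n, [N] and [G] are the free parts of 1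
    and of the centred test function, primes refer to the second law, and [X] is [n * dl]. Both
    denominators dominate [H] and [H'], so all errors are relative; the quotient itself is of order
    [th], which makes its variation of order [X * th]. The constant is 16 from the change of [G]
    plus 4 * 16 from that of the denominator. *)
Lemma ratio_diff (R : realFieldType) (H H' A A' G G' N N' X th : R) :
  0 <= X -> 0 < H' -> H' <= H -> 0 <= th -> th <= 2^-1 ->
  A <= th * H -> A' <= th * H' -> 0 <= N -> 0 <= N' -> `|G'| <= 4 * A' ->
  `|G - G'| <= 16 * X * Num.max A A' -> `|N - N'| <= 8 * X * Num.max A A' ->
  `|A - A'| <= 4 * X * Num.max A A' -> `|H - H'| <= 4 * X * H ->
  `|G / (2 * (H - A) + N) - G' / (2 * (H' - A') + N')| <= 80 * X * th.
Proof.
move=> X0 H'0 H'H th0 th2 AH A'H' N0 N'0 GA GG NN AA HH.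
have H0 : 0 < H by exact: lt_le_trans H'H.
have hM : Num.max A A' <= th * H.
  by rewrite ge_max AH (le_trans A'H')// ler_wpM2l.
set M := Num.max A A' in GG NN AA hM.
have th1 (K : R) : 0 < K -> th * K <= 2^-1 * K by move=> K0; rewrite ler_wpM2r// ltW.
have D1 : H <= 2 * (H - A) + N by have := th1 _ H0; lra.
have D2 : H' <= 2 * (H' - A') + N' by have := th1 _ H'0; lra.
set D := 2 * (H - A) + N in D1 *; set D' := 2 * (H' - A') + N' in D2 *.
have D0 : 0 < D by exact: lt_le_trans D1.
have D'0 : 0 < D' by exact: lt_le_trans D2.
have XM : X * M <= X * (th * H) by rewrite ler_wpM2l.
have XH : X * (th * H) <= X * (2^-1 * H) by rewrite ler_wpM2l// th1.
have DD : `|D - D'| <= 16 * X * H.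
  have -> : D - D' = 2 * (H - H') - 2 * (A - A') + (N - N') by rewrite /D /D'; ring.
  rewrite (le_trans (ler_normD _ _))//.
  have := ler_normB (2 * (H - H')) (2 * (A - A')).
  by rewrite !normrM (gtr0_norm (x := 2))//; lra.
have e1 : `|(G - G') / D| <= 16 * X * th.
  rewrite normrM (gtr0_norm (x := D^-1)) ?invr_gt0// ler_pdivrMr//.
  apply: (@le_trans _ _ (16 * X * th * H)); first by lra.
  by rewrite ler_wpM2l// !mulr_ge0.
have e2 : `|G' / D'| <= 4 * th.
  rewrite normrM (gtr0_norm (x := D'^-1)) ?invr_gt0// ler_pdivrMr//.
  apply: (@le_trans _ _ (4 * th * H')); first by lra.
  by rewrite ler_wpM2l// !mulr_ge0.
have e3 : `|(D - D') / D| <= 16 * X.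
  rewrite normrM (gtr0_norm (x := D^-1)) ?invr_gt0// ler_pdivrMr//.
  by rewrite (le_trans DD)// ler_wpM2l// mulr_ge0.
have -> : G / D - G' / D' = (G - G') / D - G' / D' * ((D - D') / D).
  by field; rewrite !gt_eqF.
rewrite (le_trans (ler_normB _ _))// (normrM (G' / D')).
have : `|G' / D'| * `|(D - D') / D| <= 4 * th * (16 * X) by exact: ler_pM.
by lra.
Qed.

Section dot_step.
Context (R : realType) (n : nat) (l : R).
Hypotheses (n0 : (0 < n)%N) (l01 : 0 <= l <= 1).
Implicit Types (mu nu : probability R R) (g : R -> R).

Local Notation V := (weight (@dot_weight R n) l (@cube R n)).
Local Notation dot mu := (dotR n.+1 l mu).

(** The means of [free_pow] and [one_pow] are the integrals a and s. Both indicators exclude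
    [y = 0], where the power with exponent 0 equals 1, so that products over coordinates respect the
    convention 0^0 = 0. *)
Definition free_pow (y : R) : R := \1_(`]0, 1[%classic) y * y `^ l.
Definition one_pow (y : R) : R := \1_(`]0, 1]%classic) y * y `^ l.

Lemma pow_indic01 (i : interval R) (y : R) :
  (y \in i -> 0 <= y <= 1) -> 0 <= \1_[set` i] y * y `^ l <= 1.
Proof.
rewrite indic_itvE; have [yi /(_ isT) y01|_ _] := boolP (y \in i).
  by rewrite mul1r powR_ge0 powR_le1.
by rewrite mul0r lexx ler01.
Qed.

Lemma free_pow01 y : 0 <= free_pow y <= 1.
Proof. by apply: pow_indic01; rewrite in_itv /= => /andP[? ?]; rewrite !ltW. Qed.

Lemma one_pow01 y : 0 <= one_pow y <= 1.
Proof. by apply: pow_indic01; rewrite in_itv /= => /andP[? ->]; rewrite ltW. Qed.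

Lemma bm_free_pow : bounded_measurable free_pow.
Proof.
split; last by exists 1 => y; have /andP[? ?] := free_pow01 y; rewrite ger0_norm.
apply: measurable_funM; first exact: measurable_indic.
exact: measurable_powR.
Qed.

Lemma bm_one_pow : bounded_measurable one_pow.
Proof.
split; last by exists 1 => y; have /andP[? ?] := one_pow01 y; rewrite ger0_norm.
apply: measurable_funM; first exact: measurable_indic.
exact: measurable_powR.
Qed.

Lemma dotVE t : cube t -> V t = powR00 (dot_weight t) l.
Proof. by move=> tc; rewrite /weight indicE mem_set// mul1r. Qed.

Lemma dotV_out t : ~ cube t -> V t = 0.
Proof. by move=> tc; rewrite /weight indicE memNset// mul0r. Qed.

Lemma dotV_ge0 t : 0 <= V t.
Proof. by rewrite mulr_ge0// powR00_ge0. Qed.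

Lemma dotV_le1 t : V t <= 1.
Proof.
have [tc|tc] := pselect (cube t); last by rewrite dotV_out.
rewrite dotVE// /powR00; case: ifP => // _.
by rewrite powR_le1// dot_weight_ge0// dot_weight_le1.
Qed.

Lemma bm_dotV mu : symmetric01 mu -> bounded_measurable V.
Proof.
move=> smu; split; last first.
  by exists 1 => t; rewrite ger0_norm ?dotV_ge0 ?dotV_le1.
apply: measurable_funM; first by apply: measurable_indic; exact: measurable_cube smu.
exact: (measurableT_comp (measurable_powR00 l)).
Qed.

Lemma bm_dotVg mu g : symmetric01 mu -> bounded_measurable g ->
  bounded_measurable (fun t => V t * g (dot_ratio t)).
Proof. by move=> smu bg; exact: (bm_weighted (@dot_ratio R n) (bm_dotV smu)). Qed.

Definition free_part g (t : n.-tuple R) : R :=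
  \prod_(j < n) \1_(`]0, 1[%classic) (tnth t j) * (V t * g (dot_ratio t)).

Lemma bm_free_part mu g : symmetric01 mu -> bounded_measurable g ->
  bounded_measurable (free_part g).
Proof.
move=> smu bg; apply: bm_mul; last exact: (bm_dotVg smu).
exact/bm_prod_tnth/bm_indic_itv.
Qed.

Lemma prod_pow (i : interval R) (t : n.-tuple R) : cube t ->
  \prod_(j < n) (\1_[set` i] (tnth t j) * (tnth t j) `^ l) =
  [forall j, tnth t j \in i]%:R * prodt t `^ l.
Proof.
move=> tc; rewrite big_split/= prod_indic_itv powR_prod// => j.
by have /cubeP/(_ j)/andP[] := tc.
Qed.

Lemma prod_pow_out (i : interval R) (t : n.-tuple R) : ~ cube t ->
  (forall x, x \in i -> x \in `[0, 1]) ->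
  \prod_(j < n) (\1_[set` i] (tnth t j) * (tnth t j) `^ l) = 0.
Proof.
move=> tc ix; have /existsNP[j tj] := tc.
rewrite (bigD1 j)//= indic_itvE; have [/ix ti|] := boolP (_ \in i).
  by case: tj; rewrite /= ti.
by rewrite !mul0r.
Qed.

Lemma forall_oo (t : n.-tuple R) : cube t ->
  [forall j, tnth t j \in `]0, 1[] = (prodt t != 0) && (prodtC t != 0).
Proof.
move=> tc; rewrite prodt_neq0// prodtC_neq0//.
apply/forallP/andP => [h|[/forallP h /forallP h'] j].
  by split; apply/forallP => j; have := h j; rewrite !in_itv/= => /andP[x0 x1];
     rewrite ?x0 ?x1 ?(ltW x0) ?(ltW x1).
by have := h j; have := h' j; rewrite !in_itv/= => /andP[_ ->] /andP[->].
Qed.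

Lemma prod_free_pow t : cube t -> \prod_(j < n) free_pow (tnth t j) =
  ((prodt t != 0) && (prodtC t != 0))%:R * prodt t `^ l.
Proof. by move=> tc; rewrite -forall_oo// -prod_pow. Qed.

Lemma prod_one_pow t : cube t ->
  \prod_(j < n) one_pow (tnth t j) = (prodt t != 0)%:R * prodt t `^ l.
Proof. by move=> tc; rewrite prodt_neq0// -prod_pow. Qed.

Lemma prod_free_powC t : cube t -> \prod_(j < n) free_pow (1 - tnth t j) =
  ((prodt t != 0) && (prodtC t != 0))%:R * prodtC t `^ l.
Proof.
move=> tc; have := prod_free_pow ((cube_flip t).2 tc).
rewrite prodt_flip prodtC_flip andbC => <-.
by apply: eq_bigr => j _; rewrite tnth_flip.
Qed.

Lemma prod_one_powC t : cube t ->
  \prod_(j < n) one_pow (1 - tnth t j) = (prodtC t != 0)%:R * prodtC t `^ l.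
Proof.
move=> tc; have := prod_one_pow ((cube_flip t).2 tc).
rewrite prodt_flip => <-.
by apply: eq_bigr => j _; rewrite tnth_flip.
Qed.

Lemma prod_free_pow_out t : ~ cube t -> \prod_(j < n) free_pow (tnth t j) = 0.
Proof.
move=> tc; apply: prod_pow_out => // x; rewrite !in_itv /= => /andP[? ?].
by rewrite !ltW.
Qed.

Lemma prod_one_pow_out t : ~ cube t -> \prod_(j < n) one_pow (tnth t j) = 0.
Proof.
move=> tc; apply: prod_pow_out => // x; rewrite !in_itv /= => /andP[? ->].
by rewrite ltW.
Qed.

Lemma prod_out_flip (f : R -> R) t :
  (forall t, ~ cube t -> \prod_(j < n) f (tnth t j) = 0) ->
  ~ cube t -> \prod_(j < n) f (1 - tnth t j) = 0.
Proof.
move=> h tc; rewrite -(h (flip t)); last by rewrite cube_flip.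
by apply: eq_bigr => j _; rewrite tnth_flip.
Qed.

(* The output is 1 when some input is 1 and none is 0, it is 0 in the opposite
   case, the weight vanishes when both values occur, and the free part is
   what remains. *)
Lemma dot_split g t : V t * g (dot_ratio t) =
  g 1 * (\prod_(j < n) one_pow (tnth t j) - \prod_(j < n) free_pow (tnth t j))
  + g 0 * (\prod_(j < n) one_pow (1 - tnth t j)
           - \prod_(j < n) free_pow (1 - tnth t j))
  + free_part g t.
Proof.
have [tc|tc] := pselect (cube t); last first.
  rewrite /free_part dotV_out// !mul0r mulr0 addr0.
  rewrite (prod_out_flip prod_one_pow_out)// (prod_out_flip prod_free_pow_out)//.
  by rewrite prod_one_pow_out// prod_free_pow_out// subrr !mulr0 addr0.
rewrite /free_part prod_indic_itv forall_oo//.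
rewrite prod_one_pow// prod_free_pow// prod_one_powC// prod_free_powC//.
rewrite dotVE// /powR00 /dot_ratio /dot_weight.
have [pt|pt] := eqVneq (prodt t) 0; have [qt|qt] := eqVneq (prodtC t) 0;
  rewrite /= ?mul1r ?mul0r ?subrr ?mulr0 ?add0r ?addr0 ?subr0//.
- by rewrite pt qt addr0 eqxx mul0r.
- by rewrite pt add0r (negbTE qt) mul0r mulrC.
- by rewrite qt addr0 (negbTE pt) divff// mulrC.
Qed.

(** Subadditivity of the power splits the weight into two terms, each of which factors over the
    coordinates. This is the domination that [mpow_diff] requires. *)
Lemma free_part_le g M t : (forall x, `|g x| <= M) ->
  `|free_part g t| <= M * \prod_(j < n) free_pow (tnth t j)
    + M * \prod_(j < n) free_pow (1 - tnth t j).
Proof.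
move=> gM; have M0 : 0 <= M by rewrite (le_trans _ (gM 0)).
have [tc|tc] := pselect (cube t); last first.
  rewrite /free_part dotV_out// mul0r mulr0 normr0.
  by rewrite (prod_out_flip prod_free_pow_out)// prod_free_pow_out// !mulr0 addr0.
rewrite /free_part prod_indic_itv forall_oo// prod_free_pow// prod_free_powC//.
have [h|_] := boolP (_ && _); last by rewrite !mul0r !mulr0 normr0 addr0.
have {h}/andP[pt qt] := h.
have p0 : 0 < prodt t by rewrite lt_neqAle eq_sym pt prodt_ge0.
have q0 : 0 < prodtC t by rewrite lt_neqAle eq_sym qt prodtC_ge0.
rewrite !mul1r -mulrDr normrM (ger0_norm (dotV_ge0 t)) mulrC.
apply: ler_pM; rewrite ?dotV_ge0//.
rewrite dotVE// /powR00 gt_eqF ?addr_gt0//.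
exact: powR_add_le.
Qed.

Section one_law.
Context mu (smu : symmetric01 mu).
Local Notation P := (mpow mu n).
Local Notation a := (mean mu free_pow).
Local Notation s := (mean mu one_pow).
Local Notation G g := (mean P (free_part g)).

(** Products over coordinates integrate to powers. By symmetry the reflected factors have the same
    means, so [g 1] and [g 0] receive the same coefficient. *)
Lemma mean_dotV g : bounded_measurable g ->
  mean P (fun t => V t * g (dot_ratio t)) = (g 1 + g 0) * (s ^+ n - a ^+ n) + G g.
Proof.
move=> bg; have bf := bm_free_pow; have bo := bm_one_pow.
have bf' := bm_flip bf; have bo' := bm_flip bo.
have bp (f : R -> R) : bounded_measurable f -> bounded_measurable
  (fun t : n.-tuple R => \prod_(j < n) f (tnth t j)) by exact: bm_prod_tnth.
have bfree := bm_free_part smu bg.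
have mp (f : R -> R) : bounded_measurable f ->
    mean P (fun t => \prod_(j < n) f (1 - tnth t j)) = mean mu f ^+ n.
  move=> bff; rewrite (mean_mpow_prod mu n (bm_flip bff)).
  by case: smu => _ ->.
under eq_mean do rewrite dot_split.
have b1 : bounded_measurable (fun t : n.-tuple R =>
    \prod_(j < n) one_pow (tnth t j) - \prod_(j < n) free_pow (tnth t j)).
  by apply: bm_sub; exact: bp.
have b2 : bounded_measurable (fun t : n.-tuple R =>
    \prod_(j < n) one_pow (1 - tnth t j) - \prod_(j < n) free_pow (1 - tnth t j)).
  by apply: bm_sub; [exact: bp bo'|exact: bp bf'].
rewrite mean_add//; last by apply: bm_add; exact: bm_scale.
rewrite mean_add; try exact: bm_scale.
rewrite !mean_scale// !mean_sub; try exact: bp.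
- by rewrite !mp// !mean_mpow_prod// -mulrDl.
- exact: bp bo'.
- exact: bp bf'.
Qed.

Lemma free_part_bound g (M : R) : bounded_measurable g -> (forall x, `|g x| <= M) ->
  `|G g| <= 2 * M * a ^+ n.
Proof.
move=> bg gM.
have bf := bm_prod_tnth n bm_free_pow.
have bf' := bm_prod_tnth n (bm_flip bm_free_pow).
apply: (le_trans (norm_mean P (bm_free_part smu bg) _ (fun t => free_part_le t gM))).
  by apply: bm_add; exact: bm_scale.
rewrite mean_add; try exact: bm_scale.
rewrite !mean_scale// mean_mpow_prod; last exact: bm_free_pow.
rewrite (mean_mpow_prod mu n (bm_flip bm_free_pow)).
by case: smu => _ ->; [lra|exact: bm_free_pow].
Qed.

Context (th : R).
Hypotheses (s0 : 0 < s) (th2 : th <= 2^-1) (ath : a ^+ n <= th * s ^+ n).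

Local Notation N := (2 * (s ^+ n - a ^+ n) + G (fun=> 1)).

Lemma dot_G1_ge0 : 0 <= G (fun=> 1).
Proof.
apply: mean_ge0 => t; rewrite /free_part mulr1 mulr_ge0 ?dotV_ge0//.
by apply: prodr_ge0 => j _; rewrite indic_itvE ler0n.
Qed.

Lemma dotZE : mean P V = N.
Proof.
have := mean_dotV (bm_cst _ 1); under eq_mean do rewrite mulr1.
by move=> ->.
Qed.

(** Since [th <= 1/2], subtracting [a ^+ n] leaves at least half of [s ^+ n], and this occurs twice,
    once for each of the outputs 0 and 1. *)
Lemma dotZ_ge : s ^+ n <= N.
Proof.
have H0 : 0 < s ^+ n by rewrite exprn_gt0.
have : th * s ^+ n <= 2^-1 * s ^+ n by rewrite ler_wpM2r// ltW.
by have := dot_G1_ge0; have := ath; lra.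
Qed.

Let N0 : 0 < N. Proof. by apply: lt_le_trans dotZ_ge; rewrite exprn_gt0. Qed.

Let bV := bm_dotV smu.
Let mC : measurable (@cube R n) := measurable_cube smu.
Let PC : P (@cube R n) = 1%E := mpow_cube n smu.
Let Z0 : 0 < mean P V. Proof. by rewrite dotZE. Qed.

Lemma mean_dot g : bounded_measurable g ->
  mean (dot mu) g = ((g 1 + g 0) * (s ^+ n - a ^+ n) + G g) / N.
Proof. by move=> bg; rewrite -mean_dotV// -dotZE; exact: mean_mnormalize_tilted. Qed.

Lemma dot_image (A B : set R) : measurable A -> mu A = 1%E -> measurable B ->
  (forall t : n.-tuple R, (forall i, A (tnth t i)) -> cube t -> B (dot_ratio t)) ->
  dot mu B = 1%E.
Proof.
move=> mA muA mB AB; have [mAn PAn] := mpow_full n mA muA.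
exact: (mnormalize_tilted_full _ mC PC bV Z0 mAn PAn).
Qed.

Lemma symmetric_dot : symmetric01 (dot mu).
Proof.
split.
  apply: (@dot_image `[0, 1]%classic) => //; first by case: smu.
  by move=> t _ tc; rewrite /= in_itv /= dot_ratio01.
move=> f bf.
have E g : bounded_measurable g ->
    mean (dot mu) g = mean P (fun t => V t * g (dot_ratio t)) / mean P V.
  by move=> bg; exact: mean_mnormalize_tilted.
rewrite !E//; last exact: bm_flip.
congr (_ / _); rewrite -(mean_flip smu); last exact: (bm_dotVg smu (bm_flip bf)).
apply: eq_mean => t /=.
have [tc|tc] := pselect (cube t); last first.
  by rewrite !dotV_out ?mul0r// cube_flip.
rewrite !dotVE//; last exact/cube_flip.
(* Where both products vanish, the ratio is a quotient by 0 and does not reflect to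
   [1 - dot_ratio t], but the weight there is 0 for every [l], including 0. *)
rewrite dot_weight_flip /powR00; case: ifPn => [_|w0]; first by rewrite !mul0r.
by rewrite dot_ratio_flip// subKr.
Qed.

(** The indicator of (0,1) vanishes at 0 and 1, so only the free part remains, at most [2 * a ^+ n]
    against a normaliser of at least [s ^+ n]. *)
Lemma interior_mass_dot : interior_mass (dot mu) <= 2 * th.
Proof.
have bi := bm_indic_itv (`]0, 1[ : interval R).
have b0 : \1_(`]0, 1[%classic : set R) (1 : R)
    + \1_(`]0, 1[%classic : set R) (0 : R) = 0 :> R.
  by rewrite !indic_itvE !in_itv /= !ltxx andbF addr0.
rewrite /interior_mass mean_dot// b0 mul0r add0r.
rewrite ler_pdivrMr// (le_trans (ler_norm _))//.
apply: (le_trans (@free_part_bound _ 1 bi _)).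
  by move=> x; rewrite indic_itvE; case: (_ \in _); rewrite ?normr0 ?normr1.
have a0 : 0 <= a ^+ n.
  by rewrite exprn_ge0// mean_ge0// => y; have /andP[] := free_pow01 y.
have H0 : 0 < s ^+ n by rewrite exprn_gt0.
have th0 : 0 <= th by rewrite -(pmulr_lge0 _ H0) (le_trans a0).
rewrite mulr1 -mulrA ler_wpM2l// (le_trans ath)// ler_wpM2l//.
exact: dotZ_ge.
Qed.

End one_law.

(** Centring [g] at the average of [g 0] and [g 1] removes the contribution of the two equal atoms.
    Only the free part over the normaliser is left, and its smallness supplies the factor [th]. *)
Lemma tv_le_dot mu nu th dl : symmetric01 mu -> symmetric01 nu ->
  4^-1 <= mean mu free_pow -> 4^-1 <= mean nu free_pow ->
  0 < mean mu one_pow -> 0 < mean nu one_pow ->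
  th <= 2^-1 -> mean mu free_pow ^+ n <= th * mean mu one_pow ^+ n ->
  mean nu free_pow ^+ n <= th * mean nu one_pow ^+ n ->
  tv_le mu nu dl -> tv_le (dot mu) (dot nu) (80 * (n%:R * dl) * th).
Proof.
(* With the larger s on the side of [mu], both a^n and a'^n are at most [th] times the same s^n. *)
wlog H'H : mu nu / mean nu one_pow <= mean mu one_pow => [hwlog|].
  move=> smu snu a4 a'4 s0 s'0 th2 ath a'th tv.
  have [h|h] := leP (mean nu one_pow) (mean mu one_pow); first exact: hwlog.
  by apply: tv_le_sym; apply: hwlog => //; [exact: ltW|exact: tv_le_sym].
move=> smu snu a4 a'4 s0 s'0 th2 ath a'th tv g mg g1.
have bg : bounded_measurable g by split=> //; exists 1.
pose c := (g 1 + g 0) / 2; pose h x := g x - c.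
have bh : bounded_measurable h by exact: bm_sub.
have h2 x : `|h x| <= 2.
  rewrite (le_trans (ler_normB _ _))// normrM (ger0_norm (x := 2^-1))//.
  have := ler_normD (g 1) (g 0); have := g1 x; have := g1 1; have := g1 0.
  by lra.
have Gh pi : symmetric01 pi -> mean (mpow pi n) (free_part g) =
    mean (mpow pi n) (free_part h) + c * mean (mpow pi n) (free_part (fun=> 1)).
  move=> spi; have b1 := bm_free_part spi bh.
  have b2 := bm_free_part spi (bm_cst _ 1).
  rewrite -mean_scale// -mean_add//; last exact: bm_scale.
  by apply: eq_mean => t; rewrite /free_part /h; ring.
have sub pi : symmetric01 pi -> 0 < mean pi one_pow ->
    mean pi free_pow ^+ n <= th * mean pi one_pow ^+ n ->
    mean (dot pi) g = c + mean (mpow pi n) (free_part h) /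
      (2 * (mean pi one_pow ^+ n - mean pi free_pow ^+ n)
        + mean (mpow pi n) (free_part (fun=> 1))).
  move=> spi p0 pth; rewrite (mean_dot spi p0 th2 pth)// Gh//.
  have N0 := lt_le_trans (exprn_gt0 n p0) (dotZ_ge p0 th2 pth).
  apply: (mulIf (lt0r_neq0 N0)); rewrite (mulrDl c) !divfK ?gt_eqF//.
  by rewrite /c; field.
rewrite (sub mu)// (sub nu)// opprD addrACA subrr add0r.
set a := mean mu free_pow in a4 ath *; set a' := mean nu free_pow in a'4 a'th *.
set s := mean mu one_pow in s0 ath H'H *; set s' := mean nu one_pow in s'0 a'th H'H *.
have dl0 := tv_le_ge0 tv.
have a0 : 0 <= a by rewrite (le_trans _ a4)// invr_ge0.
have a'0 : 0 <= a' by rewrite (le_trans _ a'4)// invr_ge0.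
have th0 : 0 <= th.
  by rewrite -(pmulr_lge0 _ (exprn_gt0 n s0)) (le_trans _ ath)// exprn_ge0.
have bf := bm_free_pow; have bo := bm_one_pow.
have ff y := free_pow01 y; have oo y := one_pow01 y.
(* Since the means are at least 1/4, the exponent [n.-1] produced by [mpow_diff] is raised to [n]
   for a factor 4, which makes the error relative to the n-th powers. *)
have lin (x x' y : R) : 0 <= y -> 4^-1 <= x -> 4^-1 <= x' ->
    n%:R * Num.max x x' ^+ n.-1 * y * dl <=
    4 * y * (n%:R * dl) * Num.max (x ^+ n) (x' ^+ n).
  move=> y0 x4 x'4; have xm : Num.max (x ^+ n) (x' ^+ n) = Num.max x x' ^+ n.
    have x0 : 0 <= x by rewrite (le_trans _ x4)// invr_ge0.
    have x'0 : 0 <= x' by rewrite (le_trans _ x'4)// invr_ge0.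
    have [xx|xx] := leP x x'; first by apply/max_idPr; rewrite lerXn2r.
    by apply/max_idPl; rewrite lerXn2r// ltW.
  have m4 : 4^-1 <= Num.max x x' by rewrite le_max x4.
  have m0 : 0 <= Num.max x x' by rewrite (le_trans _ m4)// invr_ge0.
  rewrite xm; set m := Num.max x x' in m4 m0 *.
  have -> : m ^+ n = m * m ^+ n.-1 by rewrite -exprS prednK.
  have mm : m ^+ n.-1 <= 4 * m * m ^+ n.-1.
    by rewrite ler_peMl ?exprn_ge0//; lra.
  have : n%:R * dl * y * m ^+ n.-1 <= n%:R * dl * y * (4 * m * m ^+ n.-1).
    by rewrite ler_wpM2l// !mulr_ge0.
  by lra.
have max_ge (x x' : R) : x <= Num.max x x' /\ x' <= Num.max x x'.
  by rewrite !le_max !lexx orbT.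
have bF f : bounded_measurable f -> bounded_measurable (free_part f).
  exact: bm_free_part smu.
have dF f M : bounded_measurable f -> (forall x, `|f x| <= M) ->
    `|mean (mpow mu n) (free_part f) - mean (mpow nu n) (free_part f)| <=
    8 * M * (n%:R * dl) * Num.max (a ^+ n) (a' ^+ n).
  move=> bff fM; have M0 : 0 <= M by rewrite (le_trans _ (fM 0)).
  have -> : 8 * M = 4 * (M + M) by ring.
  apply: le_trans (lin a a' _ _ a4 a'4); last by rewrite addr_ge0.
  have flip1 y : 0 <= free_pow (1 - y) <= 1 by exact: free_pow01.
  apply: (mpow_diff tv bf (bm_flip bf) free_pow01 flip1) => //.
  - by case: (max_ge a a').
  - by case: smu => _ ->//; case: (max_ge a a').
  - by case: (max_ge a a').
  - by case: snu => _ ->//; case: (max_ge a a').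
  - exact: bF.
  - by move=> t; exact: free_part_le.
have dP f : bounded_measurable f -> (forall x, 0 <= f x <= 1) ->
    4^-1 <= mean mu f -> 4^-1 <= mean nu f -> `|mean mu f ^+ n - mean nu f ^+ n| <=
    4 * (n%:R * dl) * Num.max (mean mu f ^+ n) (mean nu f ^+ n).
  move=> bff f01 f4 f'4.
  have -> : 4 * (n%:R * dl) = 4 * (1 + 0) * (n%:R * dl) by ring.
  apply: le_trans (lin _ _ _ _ f4 f'4); last by lra.
  rewrite -!mean_mpow_prod//.
  have [m1 m2] := max_ge (mean mu f) (mean nu f).
  apply: (mpow_diff tv bff bff f01 f01) => //.
  - exact: bm_prod_tnth.
  - move=> t; rewrite mul1r mul0r addr0 ger0_norm// prodr_ge0// => j _.
    by have /andP[] := f01 (tnth t j).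
have le_as pi : mean pi free_pow <= mean pi one_pow.
  apply: le_mean => // y; rewrite ler_wpM2r ?powR_ge0// !indic_itvE ler_nat !in_itv /=.
  by case: ltP => //= _; case: ltgtP.
have s4 : 4^-1 <= s by rewrite (le_trans a4)// le_as.
have s'4 : 4^-1 <= s' by rewrite (le_trans a'4)// le_as.
have mS : Num.max (s ^+ n) (s' ^+ n) = s ^+ n.
  by apply/max_idPl; rewrite lerXn2r// nnegrE ltW.
apply: ratio_diff => //.
- by rewrite mulr_ge0.
- by rewrite exprn_gt0.
- by rewrite lerXn2r// nnegrE ltW.
- exact: dot_G1_ge0.
- exact: dot_G1_ge0.
- rewrite (le_trans (free_part_bound snu bh h2))// -/a'.
  by have -> : 2 * 2 = 4 :> R by ring.
- have := dF h 2 bh h2; have -> : 8 * 2 = 16 :> R by ring.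
  by [].
- have := dF (fun=> 1) 1 (bm_cst _ 1); rewrite mulr1; apply => x.
  by rewrite normr1.
- exact: dP.
- by rewrite -[X in _ <= _ * X]mS; exact: dP.
Qed.

End dot_step.

(** * The contraction *)

Section numerics.
Context (R : realType).

(** The constant is 2 * 2560 * 4, the amount needed in [tv_le_RR] for a contraction factor of 1/2.
    The threshold 25 for k enters through this inequality. *)
Lemma exp2_ge (k : nat) : (25 <= k)%N ->
  20 * 32 ^+ 2 * k%:R ^+ 2 <= (2 : R) ^+ k.
Proof.
move=> k25; rewrite -(subnK k25); move: (k - 25)%N => {k k25} j.
have -> : (2 : R) ^+ (j + 25) = 32 ^+ 3 * 2 ^+ (j + 10).
  have -> : (32 : R) = 2 ^+ 5 by ring.
  by rewrite -exprM -exprD addnCA.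
have H : (j + 25)%:R ^+ 2 <= (2 : R) ^+ (j + 10).
  elim: j => [|j IH]; first by rewrite !add0n; lra.
  have -> : (2 : R) ^+ (j.+1 + 10) = 2 * 2 ^+ (j + 10) by rewrite addSn exprS.
  rewrite addSn -natr1; have : 25 <= (j + 25)%:R :> R by rewrite ler_nat leq_addl.
  move: IH; set x := (j + 25)%:R; set y := 2 ^+ _ => h1 h2.
  have : 25 * x <= x ^+ 2 by rewrite expr2 ler_wpM2r//; lra.
  by lra.
have : 0 <= (2 : R) ^+ (j + 10) by exact: exprn_ge0.
by lra.
Qed.

Lemma bernoulli_ineq (x : R) (n : nat) : 0 <= x <= 1 ->
  1 - n%:R * x <= (1 - x) ^+ n.
Proof.
move=> /andP[x0 x1]; elim: n => [|n IH]; first by rewrite mul0r subr0.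
have : (1 - n%:R * x) * (1 - x) <= (1 - x) ^+ n * (1 - x).
  by rewrite ler_wpM2r//; lra.
have : 0 <= n%:R * x * x by rewrite !mulr_ge0.
by rewrite exprSr -natr1; lra.
Qed.

(** The product of (1 + x)^n and (1 - x)^n is at most 1, and the second factor is at least 1/2 by
    Bernoulli. *)
Lemma exp1D_le2 (x : R) (n : nat) : 0 <= x <= 1 -> n%:R * x <= 2^-1 ->
  (1 + x) ^+ n <= 2.
Proof.
move=> x01 nx; have /andP[x0 x1] := x01; have b := bernoulli_ineq n x01.
have p0 : 0 <= (1 + x) ^+ n by rewrite exprn_ge0// addr_ge0.
have : (1 + x) ^+ n * (1 - x) ^+ n <= 1.
  rewrite -exprMn; apply: exprn_ile1; first by rewrite mulr_ge0//; lra.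
  by have : 0 <= x * x by [exact: mulr_ge0]; lra.
have : (1 + x) ^+ n * 2^-1 <= (1 + x) ^+ n * (1 - x) ^+ n.
  by rewrite ler_wpM2l//; lra.
by lra.
Qed.

Lemma ln2_bounds : 2^-1 <= ln (2 : R) <= 1.
Proof.
apply/andP; split; last first.
  by have := @le_ln1Dx R 1; apply; lra.
have := @le_ln1Dx R (- 2^-1); have -> : 1 + - 2^-1 = (2^-1 : R) by field.
rewrite lnV ?posrE// => h.
have : - ln 2 <= - 2^-1 :> R by apply: h; lra.
by lra.
Qed.

(* From (1 + x)^-1 = 1 - x / (1 + x) <= exp (- x / (1 + x)). *)
Lemma expR_le_1D (x : R) (n : nat) : 0 <= x ->
  expR (n%:R * (x / (1 + x))) <= (1 + x) ^+ n.
Proof.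
move=> x0; have x1 : 0 < 1 + x by lra.
rewrite expRM_natl lerXn2r ?nnegrE ?expR_ge0 ?(ltW x1)//.
have := expR_ge1Dx (- (x / (1 + x))).
have -> : 1 + - (x / (1 + x)) = (1 + x)^-1 by field; rewrite gt_eqF.
by rewrite expRN lef_pV2 ?posrE ?expR_gt0.
Qed.

(** By [expR_le_1D] it suffices that D b0/(1 + b0) >= (k - 1) ln 2, with b0 the given lower bound
    for [b]. As b0 is about 2/2^k and [D] about k 2^(k-1) ln 2, the left side is about k ln 2; the
    spare ln 2 absorbs errors of order k^2/2^k. *)
Lemma exp1D_ge (k : nat) (b : R) (D : nat) :
  (25 <= k)%N -> (1 - k%:R * (7 / 2 ^+ k)) * (2 / 2 ^+ k) <= b ->
  k%:R * (2 ^+ k / 2 - 2) * ln (2 : R) - 1 <= D%:R -> 2 ^+ k / 2 <= (1 + b) ^+ D.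
Proof.
move=> k25; have kk := exp2_ge k25.
have K_gt0 : 0 < (2 : R) ^+ k by rewrite exprn_gt0.
have KE : (2 : R) ^+ k = expR (k%:R * ln 2) by rewrite expRM_natl lnK ?posrE.
move: kk K_gt0 KE; set K := (2 : R) ^+ k => kk K0 KE hb hD.
have k25R : 25 <= k%:R :> R by rewrite ler_nat.
have /andP[l2 l1] := ln2_bounds.
have kk2 : 25 * k%:R <= k%:R ^+ 2 :> R by rewrite expr2 ler_wpM2r//; lra.
set y := K^-1 in hb *; have Ky : K * y = 1 by rewrite divff// gt_eqF.
have y0 : 0 < y by rewrite invr_gt0.
set b0 := (1 - k%:R * (7 * y)) * (2 * y) in hb.
set x := (k%:R : R) in k25R kk kk2 b0 hb hD *.
set L := ln 2 in l1 l2 hD *.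
have yK (z : R) : z <= K -> y * z <= 1.
  by move=> zK; rewrite mulrC -Ky ler_wpM2r// ltW.
(* The errors in the final product are [y * ((7 * x ^+ 2 + 6 * x) * L + 2)]; since [2 <= 4 * L],
   this inequality keeps them below the spare [L]. *)
have h1 : y * (x * (7 * x + 6) + 4) <= 1 by apply: yK; lra.
have yx0 : 0 <= y * x by rewrite mulr_ge0//; lra.
have yxx : 25 * (y * x) <= y * x ^+ 2.
  by have : 0 <= y * x * (x - 25) by [rewrite mulr_ge0//; lra]; lra.
have yyx : 0 <= y * x * y by rewrite mulr_ge0//; lra.
have b00 : 0 <= b0 by rewrite mulr_ge0//; lra.
have b0y : b0 <= 2 * y by rewrite /b0; lra.
(* From [b0 <= 2 * y] follows b0/(1 + b0) >= b0 (1 - 2y), and the cross term in (1 - 7xy)(1 - 2y) is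
   nonnegative. *)
have [c c1 c2] : exists2 c, 2 * y * (1 - (7 * x + 2) * y) <= c & c = b0 / (1 + b0).
  exists (b0 / (1 + b0)) => //; rewrite ler_pdivlMr; last by lra.
  have e1 : 0 <= b0 * (2 * y - b0) by rewrite mulr_ge0// subr_ge0.
  have e2 : b0 * (1 - 2 * y) * (1 + b0) <= b0.
    have e3 : b0 * (1 - 2 * y) * (1 + b0) = b0 - b0 * (2 * y - b0) - 2 * y * b0 * b0.
      by ring.
    have : 0 <= 2 * y * b0 * b0 by rewrite !mulr_ge0//; lra.
    by lra.
  apply: le_trans e2; rewrite ler_wpM2r//; first by lra.
  have : 0 <= 28 * y * (y * x * y) by rewrite !mulr_ge0//; lra.
  by rewrite /b0; lra.
have c0 : 0 <= 2 * y * (1 - (7 * x + 2) * y) by rewrite mulr_ge0//; lra.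
have D0 : 0 <= x * (K / 2 - 2) * L - 1.
  have k1 : 1 <= K / 2 - 2 by lra.
  have k2 : 25 * 1 <= x * (K / 2 - 2) by exact: ler_pM.
  have : 25 * 1 * 2^-1 <= x * (K / 2 - 2) * L by apply: ler_pM; lra.
  by lra.
have key : (x - 1) * L <= D%:R * c.
  apply: (@le_trans _ _
    ((x * (K / 2 - 2) * L - 1) * (2 * y * (1 - (7 * x + 2) * y)))); last first.
    by apply: ler_pM.
  have -> : (x * (K / 2 - 2) * L - 1) * (2 * y * (1 - (7 * x + 2) * y)) =
     (x * L * (K * y - 4 * y) - 2 * y) * (1 - (7 * x + 2) * y) by field.
  rewrite Ky.
  have hL : y * (x * (7 * x + 6) + 4) * L <= 1 * L by rewrite ler_wpM2r//; lra.
  have hy : y * 2^-1 <= y * L by rewrite ler_wpM2l// ltW.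
  have : 0 <= (7 * x + 2) * y * (4 * x * L * y + 2 * y).
    by rewrite !mulr_ge0 ?addr_ge0 ?mulr_ge0//; lra.
  by lra.
apply: (@le_trans _ _ ((1 + b0) ^+ D)); last first.
  by rewrite lerXn2r ?nnegrE ?lerD2l//; lra.
apply: le_trans (expR_le_1D D b00); rewrite -c2.
have -> : K / 2 = expR ((x - 1) * L).
  by rewrite /L mulrBl mul1r expRB lnK ?posrE// KE.
by rewrite ler_expR.
Qed.

End numerics.

Section contraction.
Context (R : realType) (k d : nat) (l : R).
Hypotheses (k25 : (25 <= k)%N) (l01 : 0 <= l <= 1).
Hypothesis dk :
  (2 ^+ k.-1 - 2) * ln (2 : R) <= d%:R / k%:R <= 2 ^+ k.-1 * ln (2 : R).
Implicit Types mu nu : probability R R.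

Local Notation K := ((2 : R) ^+ k).
Local Notation hat mu := (hatR k l mu).

Definition admissible mu : Prop :=
  symmetric01 mu /\ interior_mass mu <= 7 / K.

Let n0 : (0 < k.-1)%N. Proof. by case: k k25 => [|[]]. Qed.

Let KE : K = 2 * 2 ^+ k.-1.
Proof. by rewrite -exprS prednK// (leq_trans _ k25). Qed.

Let kR : 25 <= k%:R :> R. Proof. by rewrite ler_nat. Qed.

Let kK : 20 * 32 ^+ 2 * k%:R ^+ 2 <= K. Proof. exact: exp2_ge. Qed.

Let kk : 25 * k%:R <= k%:R ^+ 2 :> R.
Proof. by rewrite expr2 ler_wpM2r. Qed.

Let K0 : 0 < K. Proof. by rewrite exprn_gt0. Qed.

Let d_ge : k%:R * (K / 2 - 2) * ln 2 <= d%:R.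
Proof.
have /andP[+ _] := dk; rewrite ler_pdivlMr; last by rewrite (lt_le_trans _ kR).
have -> : K / 2 = 2 ^+ k.-1 by rewrite KE mulrC mulKf.
by rewrite mulrC mulrA.
Qed.

Let d_le : d%:R <= k%:R * K / 2.
Proof.
have /andP[_ +] := dk; rewrite ler_pdivrMr; last by rewrite (lt_le_trans _ kR).
move=> /le_trans; apply; have /andP[_ l1] := ln2_bounds R.
have -> : k%:R * K / 2 = 2 ^+ k.-1 * 1 * k%:R :> R by rewrite KE; field.
by rewrite ler_wpM2r ?ler0n// ler_wpM2l ?exprn_ge0.
Qed.

Let d_gt1 : (1 < d)%N.
Proof.
rewrite -(ltr_nat R); apply: lt_le_trans d_ge.
have /andP[l2 _] := ln2_bounds R; have h := kK; have h1 := kk; have h2 := kR.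
have k1 : 1 <= K / 2 - 2 by lra.
have k2 : 25 * 1 <= k%:R * (K / 2 - 2) by exact: ler_pM.
have : 25 * 1 * 2^-1 <= k%:R * (K / 2 - 2) * ln 2 by apply: ler_pM; lra.
by lra.
Qed.

Let D0 : (0 < d.-1)%N. Proof. by case: d d_gt1 => [|[]]. Qed.

Let dE : d.-1%:R = d%:R - 1 :> R.
Proof. by rewrite -subn1 natrB// ltnW. Qed.

Let eps01 : 0 <= 7 / K <= 1.
Proof.
rewrite divr_ge0 ?(ltW K0)//= ler_pdivrMr// mul1r.
by have h := kK; have h1 := kk; have h2 := kR; lra.
Qed.

Let keps (m : nat) : (m <= k)%N -> m%:R * (7 / K) <= 2^-1.
Proof.
move=> mk; have mk' : m%:R <= k%:R :> R by rewrite ler_nat.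
rewrite mulrA ler_pdivrMr//.
by have h := kK; have h1 := kk; have h2 := kR; lra.
Qed.

Let half_pow (x : R) (m : nat) : 0 <= x <= 7 / K -> (m <= k)%N ->
  ((1 + x) / 2) ^+ m <= 2 / 2 ^+ m.
Proof.
move=> /andP[x0 x1] mk; have /andP[e0 e1] := eps01.
rewrite expr_div_n ler_wpM2r ?invr_ge0 ?exprn_ge0// exp1D_le2//.
  by rewrite x0 (le_trans x1).
by rewrite (le_trans _ (keps mk))// ler_wpM2l.
Qed.

Section hat_facts.
Context mu (amu : admissible mu).
Let smu : symmetric01 mu. Proof. by case: amu. Qed.
Let m7 : interior_mass mu <= 7 / K. Proof. by case: amu. Qed.
Let m0 : 0 <= interior_mass mu. Proof. by have /andP[] := interior_mass01 mu. Qed.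

Lemma symmetric_hat_adm : symmetric01 (hat mu).
Proof. exact: (symmetric_hat n0 l01 smu). Qed.

Let bf := bm_free_pow l01.
Let bo := bm_one_pow l01.

(** The atom at 1/2 has mass at least 1/2, and there the integrand is 2^-l >= 1/2. *)
Lemma free_pow_half : 4^-1 <= mean (hat mu) (free_pow l).
Proof.
have q : ((1 + interior_mass mu) / 2) ^+ k.-1 <= 4 / K.
  apply: (le_trans (half_pow (m := k.-1) _ (leq_pred k))); first by rewrite m0.
  by rewrite KE invfM mulrA; have -> : 4 / 2 = 2 :> R by field.
have K4 : 4 / K <= 2^-1 / 4.
  rewrite ler_pdivrMr//.
  by have h := kK; have h1 := kk; have h2 := kR; lra.
have h := hat_atom_half n0 l01 smu.
have l1 : l <= 1 by case/andP: l01.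
have l2 : 2^-1 <= 2^-1 `^ l :> R.
  by apply: ger1_powR => //; rewrite invr_gt0 ltr0n/= invf_le1// ler1n.
have bh : bounded_measurable (\1_[set 2^-1] : R -> R) by exact: bm_indic.
apply: (@le_trans _ _ (2^-1 * mean (hat mu) \1_[set 2^-1])).
  (* Both sides unfold to the same law, because [hatR] uses its first argument only through [.-1];
     the equation identifies the two spellings for [lra]. *)
  have : mean (hat mu) \1_[set 2^-1] = mean (hatR k.-1.+1 l mu) \1_[set 2^-1] by [].
  by lra.
rewrite -mean_scale//; apply: le_mean => //; first exact: bm_scale.
move=> y; rewrite indic_set1E; have [->|_] := eqVneq y 2^-1; last first.
  by rewrite mulr0; have /andP[] := free_pow01 l01 y.
rewrite mulr1 /free_pow indic_itvE in_itv /= invr_gt0 ltr0n /=.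
by rewrite invf_lt1// ltr1n mul1r.
Qed.

(** Symmetry replaces y^l by its average with (1 - y)^l, which [powR_flip_le] bounds by the value at
    1/2. *)
Lemma free_pow_le : mean (hat mu) (free_pow l) <= 2^-1 `^ l.
Proof.
have [_ sym] := symmetric_hat_adm; have bfl := bm_flip bf.
have : mean (hat mu) (fun y => free_pow l y + free_pow l (1 - y)) <=
    mean (hat mu) (fun=> 2 * 2^-1 `^ l).
  apply: le_mean => //; first exact: bm_add.
  move=> y; rewrite /free_pow !indic_itvE flip_oo.
  have [yI|_] := boolP (y \in _); last by rewrite !mul0r addr0 mulr_ge0 ?powR_ge0.
  by rewrite !mul1r powR_flip_le//; move: yI; rewrite in_itv.
by rewrite mean_add// mean_cst sym//; lra.
Qed.

(** The two integrands differ exactly by the indicator of the point 1, whose mass is bounded below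
    in [hat_atom1]. *)
Lemma one_pow_ge : mean (hat mu) (free_pow l)
  + ((1 - interior_mass mu) / 2) ^+ k.-1 / 2 `^ l <= mean (hat mu) (one_pow l).
Proof.
have b1 : bounded_measurable (\1_[set 1] : R -> R) by exact: bm_indic.
apply: (le_trans (lerD (lexx _) (hat_atom1 n0 l01 smu))).
rewrite -mean_add//; apply: le_mean => //; first exact: bm_add.
move=> y; rewrite /free_pow /one_pow !indic_itvE indic_set1E !in_itv /=.
have [->|y1] := eqVneq y 1.
  by rewrite ltxx lexx ltr01 /= mul0r add0r powR1 mulr1.
by rewrite addr0 [y < 1]lt_neqAle y1.
Qed.

Lemma one_pow_gt0 : 0 < mean (hat mu) (one_pow l).
Proof.
have h := free_pow_half; apply: lt_le_trans one_pow_ge.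
have /andP[_ m1] := interior_mass01 mu.
have : 0 <= ((1 - interior_mass mu) / 2) ^+ k.-1 / 2 `^ l.
  by rewrite divr_ge0 ?powR_ge0 ?exprn_ge0//; lra.
by lra.
Qed.

(** The added term in [one_pow_ge] is b 2^-l, which is at least b a by [free_pow_le]; then
    [exp1D_ge] amplifies the factor 1 + b to 2^k/2. *)
Lemma free_pow_ratio : mean (hat mu) (free_pow l) ^+ d.-1 <=
  2 / K * mean (hat mu) (one_pow l) ^+ d.-1.
Proof.
set b := ((1 - interior_mass mu) / 2) ^+ k.-1.
have /andP[e0 e1] := eps01.
have bK : K / 2 <= (1 + b) ^+ d.-1.
  apply: (exp1D_ge k25); last first.
    by rewrite dE; have := d_ge; lra.
  rewrite /b expr_div_n KE.
  have -> : 2 / (2 * 2 ^+ k.-1) = (2 ^+ k.-1)^-1 :> R.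
    by rewrite invfM mulrA divff// mul1r.
  rewrite ler_wpM2r ?invr_ge0 ?exprn_ge0// -KE.
  apply: (@le_trans _ _ ((1 - 7 / K) ^+ k.-1)); last first.
    by rewrite lerXn2r ?nnegrE ?subr_ge0// ?(le_trans m7)// lerB.
  apply: le_trans (bernoulli_ineq _ eps01).
  by rewrite lerB// ler_wpM2r// ler_nat leq_pred.
set a := mean _ (free_pow l); set s := mean _ _.
have a0 : 0 <= a by apply: le_trans free_pow_half; rewrite invr_ge0.
have b0 : 0 <= b.
  by rewrite exprn_ge0// divr_ge0// subr_ge0 (le_trans m7).
have abs : (1 + b) * a <= s.
  apply: le_trans one_pow_ge; rewrite mulrDl mul1r lerD2l ler_wpM2l//.
  by rewrite (le_trans free_pow_le)// -(powR_inv1 (ler0n _ 2)) -powRrM mulN1r powRN.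
have : (K / 2) * a ^+ d.-1 <= s ^+ d.-1.
  apply: (@le_trans _ _ (((1 + b) * a) ^+ d.-1)).
    by rewrite exprMn ler_wpM2r// exprn_ge0.
  by rewrite lerXn2r ?nnegrE ?mulr_ge0 ?addr_ge0// ltW// one_pow_gt0.
move=> h; rewrite mulrAC ler_pdivlMr//.
by lra.
Qed.

Let th2 : 2 / K <= 2^-1.
Proof.
rewrite ler_pdivrMr//.
by have h := kK; have h1 := kk; have h2 := kR; lra.
Qed.

(** With [th] equal to 2/2^k, [interior_mass_dot] returns 4/2^k, below the allowed 7/2^k. *)
Lemma admissible_RR : admissible (RR k d l mu).
Proof.
split.
  exact: (symmetric_dot D0 l01 symmetric_hat_adm one_pow_gt0 th2 free_pow_ratio).
have h := interior_mass_dot D0 l01 symmetric_hat_adm one_pow_gt0 th2 free_pow_ratio.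
apply: (le_trans h); rewrite mulrA ler_wpM2r ?invr_ge0 ?(ltW K0)//.
by lra.
Qed.

(** There are finitely many tuples of points of a finite set, and each map sends them to finitely
    many ratios. *)
Lemma finite_support_RR (A : set R) : finite_set A -> mu A = 1%E ->
  exists2 B : set R, finite_set B & RR k d l mu B = 1%E.
Proof.
have fin (m : nat) (C : set R) : finite_set C ->
    finite_set [set t : m.-tuple R | forall i, C (tnth t i)].
  move=> fC; elim: m => [|m IH].
    apply: (@sub_finite_set _ _ [set [tuple]]); last exact: finite_set1.
    by move=> t _; apply/val_inj => /=; case: t => -[].
  apply: sub_finite_set (finite_image (fun p => consT p.1 p.2) (finite_setX fC IH)).
  move=> t tC; exists (thead t, [tuple of behead t]) => /=.
    split=> //= [|i]; first exact: tC.
    by rewrite tnth_behead; exact: tC.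
  by apply/val_inj => /=; case/tupleP: t {tC} => x t /=; rewrite theadE.
have mfin (C : set R) : finite_set C -> measurable C.
  by move=> /finite_set_countable; exact: countable_measurable.
move=> fA muA.
pose B1 := (@hat_ratio R k.-1) @` [set t | forall i, A (tnth t i)].
have fB1 : finite_set B1 by apply: finite_image; exact: fin.
have hB1 : hat mu B1 = 1%E.
  apply: (hat_image n0 l01 smu (mfin _ fA) muA (mfin _ fB1)).
  by move=> t tA _; exists t.
pose B2 := (@dot_ratio R d.-1) @` [set t | forall i, B1 (tnth t i)].
have fB2 : finite_set B2 by apply: finite_image; exact: fin.
exists B2 => //.
apply: (dot_image D0 l01 symmetric_hat_adm one_pow_gt0 th2 free_pow_ratio
  (mfin _ fB1) hB1 (mfin _ fB2)).
by move=> t tA _; exists t.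
Qed.

End hat_facts.

Lemma tv_le_RR mu nu dl : admissible mu -> admissible nu ->
  tv_le mu nu dl -> tv_le (RR k d l mu) (RR k d l nu) (dl / 2).
Proof.
move=> amu anu tv; have dl0 := tv_le_ge0 tv.
have [smu mu7] := amu; have [snu nu7] := anu.
have th2 : 2 / K <= 2^-1.
  rewrite ler_pdivrMr//.
  by have h := kK; have h1 := kk; have h2 := kR; lra.
have /andP[e0 e1] := eps01.
set q := (1 + 7 / K) / 2.
have hq (pi : probability R R) : interior_mass pi <= 7 / K ->
    (1 + interior_mass pi) / 2 <= q.
  by move=> h; rewrite ler_wpM2r// lerD2l.
have tvh := tv_le_hat n0 l01 smu snu (hq _ mu7) (hq _ nu7) tv.
have := tv_le_dot D0 l01 (symmetric_hat_adm amu) (symmetric_hat_adm anu)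
  (free_pow_half amu) (free_pow_half anu) (one_pow_gt0 amu) (one_pow_gt0 anu)
  th2 (free_pow_ratio amu) (free_pow_ratio anu) tvh.
move=> /tv_leW; apply.
have q8 : q ^+ k.-1.-1 <= 8 / K.
  apply: (le_trans (half_pow (x := 7 / K) (m := k.-1.-1) _ _)).
  - by rewrite e0 lexx.
  - exact: leq_trans (leq_pred _) (leq_pred _).
  - rewrite KE -(prednK n0) exprS !invfM !mulrA.
    by have -> : 8 / 2 / 2 = 2 :> R by field.
have nk : k.-1%:R <= k%:R :> R by rewrite ler_nat leq_pred.
have Dk : d.-1%:R <= k%:R * K / 2.
  by apply: le_trans d_le; rewrite ler_nat leq_pred.
have q0 : 0 <= q by rewrite divr_ge0// addr_ge0.
have nq : k.-1%:R * q ^+ k.-1.-1 <= k%:R * (8 / K) by rewrite ler_pM ?exprn_ge0.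
have Dnq : d.-1%:R * (k.-1%:R * q ^+ k.-1.-1) <= k%:R * K / 2 * (k%:R * (8 / K)).
  by rewrite ler_pM ?mulr_ge0 ?exprn_ge0.
have E : k%:R * K / 2 * (k%:R * (8 / K)) = 4 * k%:R ^+ 2 :> R.
  by field; rewrite gt_eqF.
rewrite E in Dnq.
(* Here 2560 = 80 * 16 * 2, and [Dnq] bounds the bracket by 4 k^2, so [kK] makes the whole factor at
   most 1/2. *)
have -> : 80 * (d.-1%:R * (16 * (k.-1%:R * q ^+ k.-1.-1) * dl)) * (2 / K) =
    2560 * (d.-1%:R * (k.-1%:R * q ^+ k.-1.-1)) / K * dl by field; rewrite gt_eqF.
rewrite [leRHS]mulrC ler_wpM2r// ler_pdivrMr//.
by have := kK; lra.
Qed.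

End contraction.

(** * The limit law *)

Lemma le0_of_geometric (R : realType) (x C : R) :
  (forall l : nat, x <= C / 2 ^+ l) -> x <= 0.
Proof.
move=> h; apply/ler_addgt0Pr => e e0; rewrite add0r.
have C0 : 0 <= `|C| / e by rewrite divr_ge0// ltW.
have := archi_boundP C0; set n := Num.bound _ => hn.
apply: (le_trans (h n)); rewrite ler_pdivrMr ?exprn_gt0//.
apply: (le_trans (ler_norm C)); rewrite mulrC -ler_pdivrMr//.
apply: (le_trans (ltW hn)); rewrite -natrX ler_nat ltnW//.
exact: ltn_expl.
Qed.

Section setwise_limit.
Context d (T : measurableType d) (R : realType).
Variables (m : nat -> probability T R) (C : R).
Hypothesis cauchy : forall (i j : nat) B, (i <= j)%N -> measurable B ->
  `|fine (m i B) - fine (m j B)| <= C / 2 ^+ i.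

Let e (l : nat) : R := C / 2 ^+ l.

Let C0 : 0 <= C.
Proof.
have := cauchy (leqnn 0) (@measurableT _ T).
by rewrite subrr normr0 expr0 divr1.
Qed.

Let e0 l : 0 <= e l. Proof. by rewrite divr_ge0// exprn_ge0. Qed.

(* Unlike a limit, the infimum is nonnegative on nonmeasurable sets as well. *)
Let v (B : set T) : R := inf (range (fun l => fine (m l B) + e l)).

Let v_nonempty B : range (fun l => fine (m l B) + e l) !=set0.
Proof. by exists (fine (m 0%N B) + e 0%N), 0%N. Qed.

Let v_ge0 B : 0 <= v B.
Proof.
apply: lb_le_inf => // _ [l _ <-].
by rewrite addr_ge0// fine_ge0.
Qed.

(** By the Cauchy bound, [fine (m l B) - e l] lies below every [fine (m j B) + e j], hence below
    their infimum. *)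
Lemma setwise_limit_dist l B : measurable B -> `|fine (m l B) - v B| <= e l.
Proof.
move=> mB; rewrite ler_distlC; apply/andP; split; last first.
  apply: ge_inf; last by exists l.
  by exists 0 => _ [j _ <-]; rewrite addr_ge0// fine_ge0.
apply: lb_le_inf => // _ [j _ <-].
have : fine (m l B) - fine (m j B) <= e l + e j.
  apply: le_trans (ler_norm _) _; have [lj|/ltnW jl] := leqP l j.
    by rewrite (le_trans (cauchy lj mB))// lerDl.
  by rewrite distrC (le_trans (cauchy jl mB))// lerDr.
by lra.
Qed.

Let mv (B : set T) : \bar R := (v B)%:E.

Let eq_limit (x y D : R) : (forall l, `|x - y| <= D * e l) -> x = y.
Proof.
move=> h; apply/eqP; rewrite -subr_eq0 -normr_le0.
apply: (@le0_of_geometric _ _ (D * C)) => l.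
by rewrite -mulrA; exact: h.
Qed.

Let mv0 : mv set0 = 0%E.
Proof.
congr EFin; apply: (@eq_limit _ _ 1) => l.
by rewrite distrC mul1r; have := setwise_limit_dist l (@measurable0 _ T);
  rewrite measure0.
Qed.

Let mv_ge0 B : (0 <= mv B)%E. Proof. by rewrite lee_fin. Qed.

Let v_bigcup (F : (set T)^nat) : (forall i, measurable (F i)) -> trivIset setT F ->
  forall n, v (\big[setU/set0]_(i < n) F i) = \sum_(i < n) v (F i).
Proof.
move=> mF tF n; apply: (@eq_limit _ _ (1 + n%:R)) => l.
have E : fine (m l (\big[setU/set0]_(i < n) F i)) = \sum_(i < n) fine (m l (F i)).
  rewrite measure_semi_additive//; last exact: bigsetU_measurable.
  rewrite -[RHS]/(fine (\sum_(i < n) fine (m l (F i)))%:E) -sumEFin; congr fine.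
  by apply: eq_bigr => i _; rewrite fineK//; exact: fin_num_measure.
have -> : v (\big[setU/set0]_(i < n) F i) - \sum_(i < n) v (F i) =
    (v (\big[setU/set0]_(i < n) F i) - fine (m l (\big[setU/set0]_(i < n) F i)))
    + \sum_(i < n) (fine (m l (F i)) - v (F i)).
  by rewrite sumrB E; ring.
rewrite mulrDl mul1r (le_trans (ler_normD _ _))// lerD//.
  by rewrite distrC setwise_limit_dist//; exact: bigsetU_measurable.
apply: (le_trans (ler_norm_sum _ _ _)).
apply: (@le_trans _ _ (\sum_(i < n) e l)).
  by apply: ler_sum => i _; exact: setwise_limit_dist.
by rewrite sumr_const card_ord mulr_natl.
Qed.

(** The approximation of [v] by [m l] is uniform over events. For one fixed [l] the union and all
    its partial unions are within eps/3, and sigma-additivity of [m l] supplies the last third. *)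
Let mv_sigma_additive : semi_sigma_additive mv.
Proof.
move=> F mF tF mUF.
have -> : (fun n => \sum_(0 <= i < n) mv (F i))%E =
    EFin \o (fun n => v (\big[setU/set0]_(i < n) F i)).
  by apply/funext => n; rewrite sumEFin big_mkord /= v_bigcup.
apply: cvg_EFin; first by near=> n.
apply/cvgrPdist_le => eps eps0.
have e3 : 0 < eps / 3 by rewrite divr_gt0.
have [l hl] : exists l, e l <= eps / 3.
  apply: contrapT => h; suff : eps / 3 <= 0 by rewrite leNgt e3.
  apply: (@le0_of_geometric _ _ C) => l; rewrite leNgt; apply/negP => /ltW hl.
  by apply: h; exists l.
have : (fun n => fine (\sum_(0 <= i < n) m l (F i))%E) @ \oo -->
    fine (m l (\bigcup_n F n)).
  apply: fine_cvg; rewrite fineK; last exact: fin_num_measure.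
  exact: measure_semi_sigma_additive.
move/cvgrPdist_le => /(_ _ e3); apply: filterS => n /=.
have mn : measurable (\big[setU/set0]_(i < n) F i) by exact: bigsetU_measurable.
rewrite big_mkord -measure_semi_additive// => hn.
have h1 := setwise_limit_dist l mUF; have h2 := setwise_limit_dist l mn.
set x := fine (m l (\bigcup_n F n)) in h1 hn *.
set y := fine (m l (\big[setU/set0]_(i < n) F i)) in h2 hn *.
have -> : v (\bigcup_n F n) - v (\big[setU/set0]_(i < n) F i) =
  - (x - v (\bigcup_n F n)) + (x - y) + (y - v (\big[setU/set0]_(i < n) F i)) by ring.
rewrite (le_trans (ler_normD _ _))// (le_trans (lerD (ler_normD _ _) (lexx _)))//.
by rewrite normrN; lra.
Unshelve. all: by end_near.
Qed.

HB.instance Definition _ := isMeasure.Build _ _ _ mv mv0 mv_ge0 mv_sigma_additive.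

Let mvT : mv setT = 1%E.
Proof.
congr EFin; apply: (@eq_limit _ _ 1) => l.
by rewrite distrC mul1r; have := setwise_limit_dist l (@measurableT _ T);
  rewrite [m l setT](probability_setT (m l)).
Qed.

HB.instance Definition _ := Measure_isProbability.Build _ _ _ mv mvT.

Lemma setwise_limit : exists nu : probability T R,
  forall l B, measurable B -> `|fine (m l B) - fine (nu B)| <= C / 2 ^+ l.
Proof. by exists mv => l B mB; exact: setwise_limit_dist. Qed.

End setwise_limit.

(** * Supports and mass sequences *)

Section supports.
Context (R : realType).
Implicit Types (mu nu : probability R R).

Lemma supp_subset mu (C : set R) : closed C -> mu C = 1%E -> supp mu `<=` C.
Proof.
move=> cC muC x sx; apply: contrapT => Cx.
have mC : measurable C by exact: closed_measurable.
have := sx _ (closed_openC cC) Cx.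
by rewrite [X in (_ < X)%E](probability_setC mu mC) muC subee// ltxx.
Qed.

Lemma closed_finite (A : set R) : finite_set A -> closed A.
Proof.
move: A; apply/accessible_finite_set_closed.
apply: hausdorff_accessible; exact: Rhausdorff.
Qed.

Lemma probability_setI1 mu (A B : set R) : measurable A -> measurable B ->
  mu A = 1%E -> mu B = 1%E -> mu (A `&` B) = 1%E.
Proof.
move=> mA mB muA muB.
have mAB : measurable (A `&` B) by exact: measurableI.
have bB : bounded_measurable (\1_B : R -> R) by exact: bm_indic.
rewrite -(fineK (fin_num_measure mu _ mAB)) -mean_indic//; congr EFin.
have -> : mean mu \1_(A `&` B) = mean mu (fun x => \1_A x * \1_B x).
  by apply: eq_mean => x; rewrite indicI.
by rewrite mean_indicM// mean_indic// muB.
Qed.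

Lemma supp_msum0 (mu : nat -> probability R R) : supp (msum mu 0) = set0.
Proof.
apply/seteqP; split=> // x /(_ setT openT I).
by rewrite /msum big_ord0 ltxx.
Qed.

Lemma supp_msum_subset (mu : nat -> probability R R) (j l : nat) : (j < l)%N ->
  supp (mu j) `<=` supp (msum mu l).
Proof.
move=> jl x sx U oU Ux; apply: (lt_le_trans (sx U oU Ux)).
by rewrite /msum (bigD1 (Ordinal jl))//= leeDl// sume_ge0.
Qed.

Lemma new_supp_disjoint (mu : nat -> probability R R) (i j : nat) x :
  new_supp mu i x -> new_supp mu j x -> i = j.
Proof.
move=> [si ni] [sj nj]; have [ij|ji|//] := ltngtP i j.
  by case: nj; exact: supp_msum_subset ij _ si.
by case: ni; exact: supp_msum_subset ji _ sj.
Qed.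

End supports.

(** * Enumeration of the supports and the l^1 distance *)

Section enumeration.
Context (R : realType) (S : nat -> set R).
Hypothesis finS : forall j, finite_set (S j).
Hypothesis disjS : forall i j x, S i x -> S j x -> i = j.

Lemma enum_prefixS n :
  enum_prefix S n.+1 = enum_prefix S n ++ sort <=%R (fset_set (S n)).
Proof. by rewrite /enum_prefix -addn1 iotaD map_cat flatten_cat /= cats0. Qed.

Lemma enum_prefix_cat n p : exists s, enum_prefix S (n + p) = enum_prefix S n ++ s.
Proof.
elim: p => [|p [s IH]]; first by exists [::]; rewrite addn0 cats0.
by exists (s ++ sort <=%R (fset_set (S (n + p)))); rewrite addnS enum_prefixS IH catA.
Qed.

Lemma mem_sort_fset n x : x \in sort <=%R (fset_set (S n)) -> S n x.
Proof. by rewrite mem_sort in_fset_set// inE. Qed.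

Lemma mem_enum_prefix n x : x \in enum_prefix S n -> exists2 j, (j < n)%N & S j x.
Proof.
elim: n => [//|n IH]; rewrite enum_prefixS mem_cat => /orP[/IH[j jn Sj]|/mem_sort_fset].
  by exists j => //; rewrite ltnS ltnW.
by exists n.
Qed.

Lemma uniq_enum_prefix n : uniq (enum_prefix S n).
Proof.
elim: n => [//|n IH]; rewrite enum_prefixS cat_uniq IH sort_uniq fset_uniq andbT.
apply/hasPn => x /mem_sort_fset Sn; apply/negP => /mem_enum_prefix[j jn Sj].
by move: jn; rewrite (disjS Sj Sn) ltnn.
Qed.

(** Prefixes extend one another, so the entry found at the least sufficient length persists in all
    longer ones. Two indices can then be compared inside a common prefix. *)
Lemma enum_allP i x : enum_all S i = Some x ->
  exists n, forall p, (i < size (enum_prefix S (n + p)))%N /\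
    nth 0 (enum_prefix S (n + p)) i = x.
Proof.
rewrite /enum_all; case: pselect => // ex [<-]; exists (ex_minn ex) => p.
have ie : (i < size (enum_prefix S (ex_minn ex)))%N by case: ex_minnP.
have [s ->] := enum_prefix_cat (ex_minn ex) p.
by rewrite size_cat nth_cat ie ltn_addr.
Qed.

Lemma enum_all_inj i j x : enum_all S i = Some x -> enum_all S j = Some x -> i = j.
Proof.
move=> /enum_allP[n hn] /enum_allP[p hp].
have [i1 i2] := hn p; have [j1 j2] := hp n; rewrite addnC in j1 j2.
by apply/eqP; rewrite -(nth_uniq 0 i1 j1 (uniq_enum_prefix _)) i2 j2.
Qed.

(** Duality: the signs of the differences, placed at the enumerated points, form a test function
    whose two means differ by the left-hand sum. A point is enumerated at most once, so at most one
    summand is nonzero at each [x] and the function stays in [-1, 1]. *)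
Lemma mass_seq_diff (mu nu : probability R R) (dl : R) (n : nat) :
  tv_le mu nu dl ->
  \sum_(i < n) `|mass_seq S mu i - mass_seq S nu i| <= dl.
Proof.
move=> tv.
pose D i := mass_seq S mu i - mass_seq S nu i.
pose F i (x : R) : R :=
    if enum_all S i is Some y then Num.sg (D i) * (\1_[set y] x) else 0.
have bF i : bounded_measurable (F i).
  rewrite /F; case: (enum_all S i) => [y|]; last exact: bm_cst.
  by apply: bm_scale; exact: bm_indic.
have FD i : mean mu (F i) - mean nu (F i) = `|D i|.
  rewrite /F /D /mass_seq; case: (enum_all S i) => [y|].
    have b1 : bounded_measurable (\1_[set y] : R -> R) by exact: bm_indic.
    by rewrite !mean_scale// !mean_indic// -mulrBr -normrEsg.
  by rewrite !mean_cst subrr normr0.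
have -> : \sum_(i < n) `|D i| =
    mean mu (fun x => \sum_(i < n) F i x) - mean nu (fun x => \sum_(i < n) F i x).
  rewrite !mean_sum -?sumrB; try by move=> i; exact: bF.
  by apply: eq_bigr => i _; rewrite FD.
apply: (le_trans (ler_norm _)); apply: tv.
  suff [] : bounded_measurable (fun x => \sum_(i < n) F i x) by [].
  by apply: bm_sum => i; exact: bF.
move=> x; have [[i Fi]|h] := pselect (exists i : 'I_n, F i x != 0); last first.
  rewrite big1 ?normr0// => i _; apply/eqP/negPn/negP => Fi.
  by apply: h; exists i.
have Fx (j : nat) : F j x != 0 -> enum_all S j = Some x.
  rewrite /F; case: (enum_all S j) => [y|]; last by rewrite eqxx.
  rewrite indic_set1E; have [->//|_] := eqVneq x y.
  by rewrite mulr0 eqxx.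
rewrite (bigD1 i)//= big1 ?addr0.
  rewrite /F (Fx _ Fi) indic_set1E eqxx mulr1 normr_sg.
  by case: (_ != 0).
move=> j ji; apply/eqP/negPn/negP => /Fx Ej; move/negP: ji; apply.
by apply/eqP/val_inj; exact: enum_all_inj Ej (Fx _ Fi).
Qed.

Lemma Lnorm_mass_seq_le (mu nu : probability R R) (dl : R) : tv_le mu nu dl ->
  ('N[counting]_1%E
     [(fun i => (mass_seq S mu i - mass_seq S nu i)%:E)] <= dl%:E)%E.
Proof.
move=> tv; rewrite Lnorm1 ge0_integral_count//.
apply: lime_le; first by apply: is_cvg_nneseries.
apply: nearW => n; rewrite [leLHS]sumEFin lee_fin big_mkord.
exact: mass_seq_diff.
Qed.

End enumeration.

(** * The iteration *)

Section initial_law.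
Context (R : realType).
Local Notation mu0 := (@mu_init R : probability R R).

Lemma mean_mu_init (f : R -> R) : bounded_measurable f ->
  mean mu0 f = 2^-1 * (f 0 + f 1).
Proof.
have H (g : R -> R) : measurable_fun setT g -> (forall x, 0 <= g x) ->
    mean mu0 g = 2^-1 * (g 0 + g 1).
  move=> mg g0; rewrite /mean /Rintegral.
  have g0E x : [set: R] x -> (0 <= (EFin \o g) x)%E by rewrite lee_fin.
  have mgE : measurable_fun setT (EFin \o g) by exact/measurable_EFinP.
  have := ge0_integral_measure_add (mscale (2^-1)%:nng \d_(0 : R))
    (mscale (2^-1)%:nng \d_(1 : R)) measurableT g0E mgE => /= ->.
  rewrite !ge0_integral_mscale// !integral_dirac//.
  by rewrite !diracT !mul1e -!EFinM -EFinD /= mulrDr.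
move=> bf; have [mf [M fM]] := bf.
(* Adding the bound [M] makes [f] nonnegative. *)
have := H (fun x => f x + M) (measurable_funD mf (measurable_cst _)).
rewrite mean_add// mean_cst => H'.
have : mean mu0 f + M = 2^-1 * (f 0 + M + (f 1 + M)).
  by apply: H' => x; have := fM x; rewrite ler_norml; lra.
by clear; move=> h; apply: (@addIr _ M); rewrite h; field.
Qed.

Lemma mu_init_set01 : @mu_init R [set 0; 1] = 1%E.
Proof.
rewrite mu_initE !diracE !mem_set//; [|by right|by left].
by rewrite !mule1 -EFinD; congr EFin; rewrite [RHS]splitr !mul1r.
Qed.

Lemma symmetric_mu_init : symmetric01 mu0.
Proof.
split.
  rewrite [LHS]mu_initE !diracE !mem_set//=.
  - by rewrite !mule1 -EFinD; congr EFin; rewrite [RHS]splitr !mul1r.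
  - by rewrite in_itv /= ler01 lexx.
  - by rewrite in_itv /= ler01 lexx.
move=> f bf; rewrite !mean_mu_init//; last exact: bm_flip.
by rewrite subr0 subrr addrC.
Qed.

Lemma interior_mass_mu_init : interior_mass mu0 = 0.
Proof.
rewrite /interior_mass mean_mu_init; last exact: bm_indic_itv.
by rewrite !indic_itvE !in_itv /= !ltxx andbF addr0 mulr0.
Qed.

Lemma supp_mu_init : supp (@mu_init R) = [set 0; 1].
Proof.
apply/seteqP; split.
  apply: (supp_subset (mu := mu0)); last exact: mu_init_set01.
  by apply: closed_finite; rewrite finite_setU; split; exact: finite_set1.
have h2 : (0 < (2^-1 : R)%:E)%E by rewrite lte_fin invr_gt0.
move=> x [->|->] U oU Ux; rewrite mu_initE !diracE (mem_set Ux) mule1.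
  by rewrite (lt_le_trans h2)// leeDl// mule_ge0// ?lee_fin// ltW.
by rewrite (lt_le_trans h2)// leeDr// mule_ge0// ?lee_fin// ltW.
Qed.

End initial_law.

Section iteration.
Context (R : realType) (k d : nat) (l : R).
Hypotheses (k25 : (25 <= k)%N) (l01 : 0 <= l <= 1).
Hypothesis dk :
  (2 ^+ k.-1 - 2) * ln (2 : R) <= d%:R / k%:R <= 2 ^+ k.-1 * ln (2 : R).

Local Notation mu := (mu_iter k d l).
Local Notation adm := (@admissible R k).

Lemma admissible_mu_iter i : adm (mu i).
Proof.
elim: i => [|i IH]; last exact: admissible_RR.
split; first exact: symmetric_mu_init.
by rewrite [leLHS]interior_mass_mu_init divr_ge0// exprn_ge0.
Qed.

Lemma finite_support_mu_iter i :
  exists2 A : set R, finite_set A & mu i A = 1%E.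
Proof.
elim: i => [|i [A fA muA]].
  exists [set 0; 1]; last exact: mu_init_set01.
  by rewrite finite_setU; split; exact: finite_set1.
exact: (finite_support_RR k25 l01 dk (admissible_mu_iter i) fA muA).
Qed.

Lemma tv_le_mu_iterS i : tv_le (mu i) (mu i.+1) (2 / 2 ^+ i).
Proof.
elim: i => [|i IH].
  move=> f mf f1; have bf : bounded_measurable f by split=> //; exists 1.
  rewrite expr0 divr1 (le_trans (ler_normB _ _))//.
  by rewrite (le_trans (lerD (norm_mean_le _ bf f1) (norm_mean_le _ bf f1))).
have := tv_le_RR k25 l01 dk (admissible_mu_iter i) (admissible_mu_iter i.+1) IH.
by move=> /tv_leW; apply; rewrite exprSr invfM mulrA.
Qed.

Lemma tv_le_mu_iter i j : (i <= j)%N -> tv_le (mu i) (mu j) (4 / 2 ^+ i).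
Proof.
move=> ij; rewrite -(subnKC ij); move: (j - i)%N => {ij} p.
(* The exact partial sum of the geometric series is what the induction on [p] can carry. *)
suff /tv_leW : tv_le (mu i) (mu (i + p)) (4 / 2 ^+ i - 4 / 2 ^+ (i + p)).
  by apply; rewrite gerBl divr_ge0// exprn_ge0.
elim: p => [|p IH].
  by move=> f _ _; rewrite addn0 !subrr normr0.
rewrite addnS; apply: tv_leW (tv_le_trans IH (tv_le_mu_iterS (i + p))) _.
by rewrite exprSr; have : 4 / (2 ^+ (i + p) * 2) = 2 / 2 ^+ (i + p) :> R;
  [field; rewrite expf_neq0|lra].
Qed.

Lemma limit_law : exists nu : probability R R,
  [/\ adm nu, discrete01 nu, forall i, tv_le (mu i) nu (8 / 2 ^+ i)
    & forall B, measurable B -> nu B = RR k d l nu B].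
Proof.
have [|nu hnu] := @setwise_limit _ _ R mu 4.
  move=> i j B ij mB; rewrite -!mean_indic//; apply: (tv_le_mu_iter ij).
    exact: measurable_indic.
  by move=> x; rewrite indicE; case: (_ \in _); rewrite ?normr1 ?normr0.
have tvn i : tv_le (mu i) nu (8 / 2 ^+ i).
  have -> : 8 / 2 ^+ i = 2 * (4 / 2 ^+ i) :> R by field; rewrite expf_neq0.
  exact/tv_le_sets/hnu.
have full B : measurable B -> (forall i, mu i B = 1%E) -> nu B = 1%E.
  move=> mB h; rewrite -(fineK (fin_num_measure nu B mB)); congr EFin.
  apply/eqP; rewrite -subr_eq0 -normr_le0.
  apply: (@le0_of_geometric _ _ 4) => i.
  by rewrite distrC; have := hnu i B mB; rewrite h.
have nu01 : nu `[0, 1]%classic = 1%E.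
  by apply: full => // i; have [[]] := admissible_mu_iter i.
have anu : adm nu.
  split; first split=> //.
    move=> f bf; have [mf [M fM]] := bf; have bf' := bm_flip bf.
    have M0 : 0 <= M by rewrite (le_trans _ (fM 0)).
    apply/eqP; rewrite -subr_eq0 -normr_le0.
    apply: (@le0_of_geometric _ _ (M * 16)) => i.
    have [[_ sym] _] := admissible_mu_iter i.
    have h1 := tv_le_scale (tvn i) mf M0 fM.
    have h2 := tv_le_scale (tvn i) bf'.1 M0 (fun x => fM (1 - x)).
    rewrite sym// in h2.
    have -> : mean nu (fun x => f (1 - x)) - mean nu f =
        (mean (mu i) f - mean nu f) - (mean (mu i) f - mean nu (fun x => f (1 - x))).
      by ring.
    rewrite (le_trans (ler_normB _ _))//.
    have -> : M * 16 / 2 ^+ i = M * (8 / 2 ^+ i) + M * (8 / 2 ^+ i).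
      by field; rewrite expf_neq0.
    exact: lerD.
  rewrite -subr_le0; apply: (@le0_of_geometric _ _ 8) => i.
  have [_ h7] := admissible_mu_iter i.
  have bi := bm_indic_itv (`]0, 1[ : interval R).
  have : `|interior_mass (mu i) - interior_mass nu| <= 8 / 2 ^+ i.
    apply: tvn; first by case: bi.
    by move=> x; rewrite indic_itvE; case: (_ \in _); rewrite ?normr1 ?normr0.
  by rewrite ler_norml => /andP[? ?]; lra.
exists nu; split=> //.
(* Each iterate lives on a finite set. The countable union of these sets, cut to [0, 1], has mass 1
   under every iterate, hence under the limit. *)
- have /choice[A hA] : forall i, exists A : set R, finite_set A /\ mu i A = 1%E.
    by move=> i; have [A ? ?] := finite_support_mu_iter i; exists A.
  have cA : countable (\bigcup_i A i).
    by apply: bigcup_countable => // i _; apply: finite_set_countable; case: (hA i).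
  have cB : countable (\bigcup_i A i `&` `[0, 1]%classic).
    by apply: sub_countable cA; apply: subset_card_le; exact: subIsetl.
  exists (\bigcup_i A i `&` `[0, 1]%classic); split=> //.
  have cm (C : set R) : countable C -> measurable C by exact: countable_measurable.
  have mB := cm _ cB.
  apply: full => // i; apply/eqP; rewrite eq_le probability_le1//=.
  have [fA muA] := hA i; have mA := cm _ (finite_set_countable fA).
  have [[mu01 _] _] := admissible_mu_iter i.
  rewrite -(probability_setI1 mA (measurable_itv `[0, 1]) muA mu01).
  apply: le_measure; rewrite ?inE//; first exact: measurableI.
  by move=> x [Ax x01]; split=> //; exists i.
(* The iterate of index [i.+1] is close to [nu] by convergence, and close to the image of [nu] by
   contraction, which applies since [nu] is itself admissible. *)
- move=> B mB.
  rewrite -(fineK (fin_num_measure nu B mB)).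
  rewrite -(fineK (fin_num_measure (RR k d l nu) B mB)).
  congr EFin; apply/eqP; rewrite -subr_eq0 -normr_le0.
  apply: (@le0_of_geometric _ _ 8) => i.
  have h1 := tv_le_RR k25 l01 dk (admissible_mu_iter i) anu (tvn i).
  have := tv_le_trans (tv_le_sym (tvn i.+1)) h1.
  have -> : 8 / 2 ^+ i.+1 + 8 / 2 ^+ i / 2 = 8 / 2 ^+ i :> R.
    by rewrite exprS; field; rewrite expf_neq0.
  move=> /(_ \1_B); rewrite !mean_indic//; apply; first exact: measurable_indic.
  by move=> x; rewrite indicE; case: (_ \in _); rewrite ?normr1 ?normr0.
Qed.

(** Finiteness ensures that [enum_prefix] really lists these sets, as [fset_set] is empty on an
    infinite set. *)
Lemma new_supp_mu_iter i :
  finite_set (new_supp mu i) /\ new_supp mu i `<=` `[0, 1]%classic.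
Proof.
have [A fA muA] := finite_support_mu_iter i.
have [[mu01 _] _] := admissible_mu_iter i.
split.
  apply: (sub_finite_set _ fA) => x [sx _].
  exact: (supp_subset (closed_finite fA) muA).
have c01 : closed (`[0, 1]%classic : set R) by exact: itv_closed.
by move=> x [sx _]; exact: (supp_subset c01 mu01).
Qed.

Lemma new_supp_mu_iter0 : new_supp mu 0 = [set 0; 1].
Proof. by rewrite /new_supp supp_msum0 setD0 [LHS]supp_mu_init. Qed.

End iteration.

Theorem proposition1p2 :
  exists k0 : nat, forall (R : realType) (k d : nat) (lambda : R),
    (k0 <= k)%N ->
    (2 ^+ k.-1 - 2) * ln (2 : R) <= d%:R / k%:R <= 2 ^+ k.-1 * ln (2 : R) ->
    0 <= lambda <= 1 ->
    let mu := mu_iter k d lambda in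
    let S := new_supp mu in
    [/\ forall l, finite_set (S l) /\ S l `<=` `[0, 1],
        S 0%N = [set 0; 1]
      & exists nu : probability R R,
        [/\ discrete01 nu,
            ('N[counting]_1%E
               [(fun i => (mass_seq S (mu l) i - mass_seq S nu i)%:E)])%E
              @[l --> \oo] --> 0%E,
            forall B, measurable B -> nu B = RR k d lambda nu B,
            (nu `]0%R, 1%R[%classic <= (7 / 2 ^+ k)%:E)%E
          & forall B, measurable B ->
              nu B = pushforward nu (fun x : R => 1 - x) B]].
Proof.
exists 25%N => R k d lambda k25 dk l01 mu S.
have newS := new_supp_mu_iter k25 l01 dk.
split=> //; first exact: new_supp_mu_iter0.
have [nu [[[nu01 sym] nu7] dnu tvn fix_nu]] := limit_law k25 l01 dk.
exists nu; split=> //.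
- have e0 : (fun l => (8 / 2 ^+ l : R)%:E) @ \oo --> 0%E.
    apply: cvg_EFin; first by near=> l.
    have -> : fine \o (fun l => (8 / 2 ^+ l : R)%:E) = geometric 8 2^-1.
      by apply/funext => l; rewrite /= exprVn.
    by apply: cvg_geometric; rewrite ger0_norm// invf_lt1// ltr1n.
  apply: (squeeze_cvge _ (cvg_cst 0%E) e0).
  apply: nearW => l; rewrite Lnorm_ge0/=.
  apply: Lnorm_mass_seq_le => //; first by move=> j; case: (newS j).
  exact: new_supp_disjoint.
- rewrite -(fineK (fin_num_measure nu _ (measurable_itv _))) lee_fin.
  by rewrite -mean_indic.
- move=> B mB.
  have mB' : measurable ((fun x : R => 1 - x) @^-1` B).
    by rewrite -[X in measurable X]setTI; apply: measurable_funB.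
  rewrite /pushforward -(fineK (fin_num_measure nu _ mB)).
  rewrite -(fineK (fin_num_measure nu _ mB')).
  rewrite -!mean_indic// -sym; last exact: bm_indic.
  by congr EFin; apply: eq_mean => x; rewrite preimage_indic.
Unshelve. all: by end_near.
Qed.
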